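(* Let $\psi_a=\mu(\phi_p,\delta_q)y$, $\mu\in R[\xi_p,\xi_q]$, be a non-degenerate $\{\delta_p,\delta_q\}$-character of $\mathbb G_a$ over $R$, and let $\varphi\in q^{\pm1}R[[q^{\pm1}]]$ be a series whose support is contained in the set $\mathcal K'$ of totally non-characteristic integers of $\psi_a$. Then: 1) The equation $\psi_au=\varphi$ has a unique solution $u\in\mathbb G_a(q^{\pm1}R[[q^{\pm1}]])=q^{\pm1}R[[q^{\pm1}]]$ such that $u$ has support disjoint from the set $\mathcal K$ of characteristic integers. 2) If the reduction $\bar\varphi$ of $\varphi$ mod $p$ lies in $k[q^{\pm1}]$, then the reduction $\bar u\in k[[q^{\pm1}]]$ of this solution $u$ is integral over $k[q^{\pm1}]$, and the field extension $k(q)\subset k(q,\bar u)$ is Abelian with Galois group killed by $p$. 3) If the characteristic polynomial $\mu$ of $\psi_a$ is unmixed and the support of $\varphi$ is short, then $u$ is transcendental over $K(q)$. (Here $q^{\pm1}$ stands consistently for $q$ or consistently for $q^{-1}$; $k[q^{\pm1}]$ means $k[q]$, resp. $k[q^{-1}]$.)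
   Context: $p\ne 2$ is a prime, $R$ is the completion of the maximal unramified extension of $\mathbb Z_p$, $K=R[1/p]$, $k=R/pR$, $\phi:R\to R$ the unique automorphism lifting the $p$-power Frobenius on $k$. On $R[[q^{\pm1}]]$, $\phi_p(\sum a_nq^n)=\sum\phi(a_n)q^{pn}$ and $\delta_q(\sum a_nq^n)=\sum na_nq^n$. For $\mu(\xi_p,\xi_q)=\sum\mu_{ij}\xi_p^i\xi_q^j\in R[\xi_p,\xi_q]$, the character $\psi_a=\mu(\phi_p,\delta_q)y$ acts by $\psi_a u=\sum\mu_{ij}\phi_p^i\delta_q^ju$; $\mu$ is its characteristic polynomial. It is non-degenerate if $\mu(0,0)\in R^\times$. A characteristic integer is $\kappa\in\mathbb Z$ with $\mu(0,\kappa)=0$. A totally non-characteristic integer is $\kappa\in\mathbb Z$ with $\kappa\not\equiv0$ mod $p$ and $\mu(0,\kappa)\not\equiv0$ mod $p$. The support of $\sum c_nq^n$ is $\{n:c_n\ne0\}$. $\mu$ is unmixed if, with $\bar\mu_{ij}$ the reductions mod $p$ of its coefficients, $\bar\mu_{ij}=0$ whenever $ij\neq0$, and $\bar\mu_{i0}\ne0$ for some $i\neq0$. A non-empty finite set $S$ of positive integers is short if $\max S/\min S<p/2$; a set $S$ of negative integers is short if $-S$ is short. *)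

(* Defs.v *)
From HB Require Import structures.
From mathcomp Require Import all_boot all_order all_algebra all_fingroup all_field.
From mathcomp Require Import boolp classical_sets cardinality.

Set Implicit Arguments.
Unset Strict Implicit.
Unset Printing Implicit Defensive.

Import Order.TTheory GRing.Theory Num.Theory.
Local Open Scope ring_scope.

Record pseries (R : Type) := PSeries { coefs : nat -> R }.
Arguments PSeries {R} _.
Arguments coefs {R} _ _.

Lemma pseriesP (R : Type) (f g : pseries R) : coefs f =1 coefs g -> f = g.
Proof. by case: f g => f [g] /= /funext ->. Qed.

HB.instance Definition _ (R : Type) := gen_eqMixin (pseries R).
HB.instance Definition _ (R : Type) := gen_choiceMixin (pseries R).

Section PSeriesRing.
Variable R : idomainType.
Implicit Types f g h : pseries R.

Definition pseries0 : pseries R := PSeries (fun=> 0).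
Definition pseries1 : pseries R := PSeries (fun n => (n == 0%N)%:R).
Definition pseries_add f g := PSeries (fun n => coefs f n + coefs g n).
Definition pseries_opp f := PSeries (fun n => - coefs f n).
Definition pseries_mul f g :=
  PSeries (fun n => \sum_(i < n.+1) coefs f i * coefs g (n - i)).
Definition pseries_scale (c : R) f := PSeries (fun n => c * coefs f n).

Fact pseries_addA : associative pseries_add.
Proof. by move=> f g h; apply: pseriesP => n /=; rewrite addrA. Qed.
Fact pseries_addC : commutative pseries_add.
Proof. by move=> f g; apply: pseriesP => n /=; rewrite addrC. Qed.
Fact pseries_add0 : left_id pseries0 pseries_add.
Proof. by move=> f; apply: pseriesP => n /=; rewrite add0r. Qed.
Fact pseries_addN : left_inverse pseries0 pseries_opp pseries_add.
Proof. by move=> f; apply: pseriesP => n /=; rewrite addNr. Qed.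

HB.instance Definition _ := GRing.isZmodule.Build (pseries R)
  pseries_addA pseries_addC pseries_add0 pseries_addN.

Let trunc n f : {poly R} := \poly_(i < n) coefs f i.

Let trunc_mul n f g i : (i < n)%N ->
  coefs (pseries_mul f g) i = (trunc n f * trunc n g)`_i.
Proof.
move=> lt_in; rewrite coefM; apply: eq_bigr => j _.
by rewrite !coef_poly (leq_ltn_trans (leq_ord j) lt_in)
           (leq_ltn_trans (leq_subr j i) lt_in).
Qed.

Let coef_trunc n (p q p' q' : {poly R}) i : (i < n)%N ->
  (forall j, (j < n)%N -> p`_j = p'`_j) -> (forall j, (j < n)%N -> q`_j = q'`_j) ->
  (p * q)`_i = (p' * q')`_i.
Proof.
move=> lt_in Ep Eq; rewrite !coefM; apply: eq_bigr => j _.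
by rewrite Ep ?Eq ?(leq_ltn_trans (leq_subr j i) lt_in) //
           (leq_ltn_trans (leq_ord j) lt_in).
Qed.

Fact pseries_mulC : commutative pseries_mul.
Proof.
move=> f g; apply: pseriesP => n.
by rewrite !(@trunc_mul n.+1) // mulrC.
Qed.

Fact pseries_mulA : associative pseries_mul.
Proof.
move=> f g h; apply: pseriesP => n.
rewrite !(@trunc_mul n.+1) //.
rewrite (@coef_trunc n.+1 _ _ (trunc n.+1 f) (trunc n.+1 g * trunc n.+1 h)) //; last first.
  by move=> j lt_j; rewrite coef_poly lt_j (@trunc_mul n.+1).
rewrite [RHS](@coef_trunc n.+1 _ _ (trunc n.+1 f * trunc n.+1 g) (trunc n.+1 h)) //; last first.
  by move=> j lt_j; rewrite coef_poly lt_j (@trunc_mul n.+1).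
by rewrite mulrA.
Qed.

Fact pseries_mul1 : left_id pseries1 pseries_mul.
Proof.
move=> f; apply: pseriesP => n /=.
rewrite big_ord_recl /= mul1r subn0 big1 ?addr0 // => i _.
by rewrite /bump /= mul0r.
Qed.

Fact pseries_mulDl : left_distributive pseries_mul pseries_add.
Proof.
move=> f g h; apply: pseriesP => n /=.
by rewrite -big_split; apply: eq_bigr => i _; rewrite /= mulrDl.
Qed.

Fact pseries1_neq0 : pseries1 != 0.
Proof.
by apply/eqP => /(congr1 (fun f => coefs f 0)) /eqP; rewrite /= oner_eq0.
Qed.

HB.instance Definition _ := GRing.Zmodule_isComNzRing.Build (pseries R)
  pseries_mulA pseries_mulC pseries_mul1 pseries_mulDl pseries1_neq0.

Definition pseries_unit : pred (pseries R) := fun f => `[< exists g, g * f = 1 >].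
Definition pseries_inv f : pseries R :=
  if pselect (exists g, g * f = 1) is left ex_g then projT1 (cid ex_g) else f.

Fact pseries_mulV : {in pseries_unit, left_inverse 1 pseries_inv *%R}.
Proof.
move=> f /asboolP ex_g; rewrite /pseries_inv.
by case: pselect => // ?; case: cid.
Qed.
Fact pseries_unitPl f g : g * f = 1 -> pseries_unit f.
Proof. by move=> gf1; apply/asboolP; exists g. Qed.
Fact pseries_inv_out : {in [predC pseries_unit], pseries_inv =1 id}.
Proof.
move=> f /negP nf; rewrite /pseries_inv; case: pselect => // ex_g.
by case: nf; apply/asboolP.
Qed.

HB.instance Definition _ := GRing.ComNzRing_hasMulInverse.Build (pseries R)
  pseries_mulV pseries_unitPl pseries_inv_out.

Let low f : f != 0 -> exists2 n, coefs f n != 0 &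
  forall i, (i < n)%N -> coefs f i = 0.
Proof.
move=> nz_f; have ex_n : exists n, coefs f n != 0.
  apply/not_existsP => f0; case/eqP: nz_f; apply: pseriesP => n /=.
  by apply/eqP; apply: contra_notT (f0 n).
case: (ex_minnP ex_n) => n nz_n min_n; exists n => // i lt_in.
by apply/eqP; apply: contraTT lt_in => /min_n; rewrite -leqNgt.
Qed.

Fact pseries_idomain : GRing.integral_domain_axiom (pseries R).
Proof.
move=> f g fg0; apply/norP => -[/low[m fm minf] /low[n gn ming]].
move/(congr1 (fun h => coefs h (m + n)%N)): fg0 => /=.
have lt_m : (m < (m + n).+1)%N by rewrite ltnS leq_addr.
rewrite (bigD1 (Ordinal lt_m)) //= addKn big1 ?addr0 => [/eqP|i].
  by rewrite mulf_eq0 (negPf fm) (negPf gn).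
rewrite -val_eqE /= => ne_im; case: (ltnP i m) => [/minf-> | le_mi].
  by rewrite mul0r.
rewrite (ming (m + n - i)%N) ?mulr0 //.
by rewrite ltn_subLR 1?ltn_add2r ?(ltn_neqAle m) 1?eq_sym ?ne_im // -ltnS.
Qed.

HB.instance Definition _ :=
  GRing.ComUnitRing_isIntegral.Build (pseries R) pseries_idomain.

Fact pseries_scaleA a b f :
  pseries_scale a (pseries_scale b f) = pseries_scale (a * b) f.
Proof. by apply: pseriesP => n /=; rewrite mulrA. Qed.
Fact pseries_scale1 : left_id 1 pseries_scale.
Proof. by move=> f; apply: pseriesP => n /=; rewrite mul1r. Qed.
Fact pseries_scaleDr : right_distributive pseries_scale +%R.
Proof. by move=> a f g; apply: pseriesP => n /=; rewrite mulrDr. Qed.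
Fact pseries_scaleDl f : {morph pseries_scale^~ f : a b / a + b}.
Proof. by move=> a b; apply: pseriesP => n /=; rewrite mulrDl. Qed.

HB.instance Definition _ := GRing.Zmodule_isLmodule.Build R (pseries R)
  pseries_scaleA pseries_scale1 pseries_scaleDr pseries_scaleDl.

Definition pseries_of_poly (P : {poly R}) : pseries R := PSeries (fun n => P`_n).

Fact pseries_of_poly_zmod_morphism : zmod_morphism pseries_of_poly.
Proof. by move=> P Q; apply: pseriesP => n /=; rewrite coefB. Qed.
Fact pseries_of_poly_monoid_morphism : monoid_morphism pseries_of_poly.
Proof.
split=> [|P Q]; apply: pseriesP => n /=; first by rewrite coef1.
exact: coefM.
Qed.

HB.instance Definition _ := GRing.isZmodMorphism.Build {poly R} (pseries R)
  pseries_of_poly pseries_of_poly_zmod_morphism.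
HB.instance Definition _ := GRing.isMonoidMorphism.Build {poly R} (pseries R)
  pseries_of_poly pseries_of_poly_monoid_morphism.

Lemma pseries_of_poly_inj : injective pseries_of_poly.
Proof.
move=> P Q E; apply/polyP => i.
exact: (congr1 (fun u => coefs u i) E).
Qed.

End PSeriesRing.

Definition map_pseries (R S : Type) (f : R -> S) (u : pseries R) : pseries S :=
  PSeries (fun n => f (coefs u n)).

(* The inclusion R(t) -> R((t)), where both sides are fraction fields.        *)

Section RatfunToLaurent.
Variable R : idomainType.

Definition ratfun_to_laurent (x : {fraction {poly R}}) : {fraction (pseries R)} :=
  tofrac (pseries_of_poly \n_(generic_quotient.repr x))
    / tofrac (pseries_of_poly \d_(generic_quotient.repr x)).

Let emb (P : {poly R}) : {fraction (pseries R)} :=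
  tofrac (pseries_of_poly P).

Let embM P Q : emb (P * Q) = emb P * emb Q.
Proof. by rewrite /emb (rmorphM (@pseries_of_poly R)) tofracM. Qed.
Let embB P Q : emb (P - Q) = emb P - emb Q.
Proof. by rewrite /emb (rmorphB (@pseries_of_poly R)) tofracB. Qed.

Let emb_eq0 P : (emb P == 0) = (P == 0).
Proof.
rewrite /emb tofrac_eq0 -(inj_eq (@pseries_of_poly_inj R)).
by rewrite (rmorph0 (@pseries_of_poly R)).
Qed.

Let fracE (x : {fraction {poly R}}) :
  x = tofrac \n_(generic_quotient.repr x) / tofrac \d_(generic_quotient.repr x).
Proof.
have nz_d : tofrac \d_(generic_quotient.repr x) != 0.
  by rewrite tofrac_eq0 denom_ratioP.
apply: (canRL (mulfK nz_d)); rewrite -[x in x * _]reprK.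
rewrite /tofrac; unlock; rewrite -[LHS]FracField.pi_mul.
apply/eqmodP; rewrite /= FracField.equivfE /FracField.mulf.
rewrite !numden_Ratio ?mulf_neq0 ?denom_ratioP ?oner_eq0 //.
by rewrite !mulr1 mulrC.
Qed.

Lemma ratfun_to_laurentE (P Q : {poly R}) : Q != 0 ->
  ratfun_to_laurent (tofrac P / tofrac Q) =
  tofrac (pseries_of_poly P) / tofrac (pseries_of_poly Q).
Proof.
move=> nz_Q; rewrite /ratfun_to_laurent -!/(emb _).
move Dx: (tofrac P / _) => x; move/eqP: (fracE x); rewrite -{1}Dx eq_sym.
rewrite eqr_div ?tofrac_eq0 ?denom_ratioP // -!tofracM tofrac_eq => /eqP E.
by apply/eqP; rewrite eqr_div ?emb_eq0 ?denom_ratioP // -!embM E.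
Qed.

Let fracW (x : {fraction {poly R}}) : exists P Q : {poly R},
  Q != 0 /\ x = tofrac P / tofrac Q.
Proof.
by exists \n_(generic_quotient.repr x), \d_(generic_quotient.repr x); split; [apply: denom_ratioP | apply: fracE].
Qed.

Fact ratfun_to_laurent_zmod_morphism : zmod_morphism ratfun_to_laurent.
Proof.
move=> x y; have [P [Q [nzQ ->]]] := fracW x; have [P' [Q' [nzQ' ->]]] := fracW y.
rewrite -mulNr addf_div ?tofrac_eq0 // -tofracN -!tofracM -tofracD.
rewrite !ratfun_to_laurentE ?mulf_neq0 // -!/(emb _).
rewrite -[in RHS]mulNr addf_div ?emb_eq0 // mulNr -!embM.
by rewrite embB (embM P' Q) mulNr.
Qed.

Fact ratfun_to_laurent_monoid_morphism : monoid_morphism ratfun_to_laurent.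
Proof.
split=> [|x y].
  rewrite -[1]divr1 -tofrac1 ratfun_to_laurentE ?oner_eq0 //.
  by rewrite (rmorph1 (@pseries_of_poly R)) tofrac1 divr1.
have [P [Q [nzQ ->]]] := fracW x; have [P' [Q' [nzQ' ->]]] := fracW y.
rewrite mulf_div -!tofracM !ratfun_to_laurentE ?mulf_neq0 // -!/(emb _).
by rewrite !embM mulf_div.
Qed.

HB.instance Definition _ := GRing.isZmodMorphism.Build
  {fraction {poly R}} {fraction (pseries R)}
  ratfun_to_laurent ratfun_to_laurent_zmod_morphism.
HB.instance Definition _ := GRing.isMonoidMorphism.Build
  {fraction {poly R}} {fraction (pseries R)}
  ratfun_to_laurent ratfun_to_laurent_monoid_morphism.

End RatfunToLaurent.

Lemma ratfun_to_laurent_poly (R : idomainType) (P : {poly R}) :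
  ratfun_to_laurent (tofrac P) = tofrac (pseries_of_poly P).
Proof.
rewrite -[tofrac P]divr1 -tofrac1 ratfun_to_laurentE ?oner_eq0 //.
by rewrite (rmorph1 (@pseries_of_poly R)) tofrac1 divr1.
Qed.

Definition pdvd (p n : nat) (A : idomainType) (x : A) : Prop :=
  exists y : A, x = p%:R ^+ n * y.

(* [b] exhibits [B] as the projective limit of the quotients A/p^n A: [B] is
   p-adically separated and complete, and [b] induces isomorphisms
   A/p^n A -> B/p^n B.                                                        *)
Definition padic_completion (p : nat) (A B : idomainType) (b : {rmorphism A -> B}) :
    Prop :=
  [/\ forall x : B, (forall n, pdvd p n x) -> x = 0,
      forall f : nat -> B, (forall n, pdvd p n (f n.+1 - f n)) ->
        exists l : B, forall n, pdvd p n (l - f n),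
      forall (x : B) n, exists a : A, pdvd p n (x - b a) &
      forall (a : A) n, pdvd p n (b a) -> pdvd p n a].

(* Finite unramified extensions of the ring of p-adic integers [Zp]: module-finite,
   injective, with [O] local of maximal ideal pO. Separability of the residue
   extension is automatic, the residue field of [Zp] being perfect.           *)
Definition finite_unramified (p : nat) (Zp O : idomainType) (j : {rmorphism Zp -> O}) :
    Prop :=
  [/\ injective j,
      exists s : seq O, forall x : O, exists c : nat -> Zp,
        x = \sum_(i < size s) j (c i) * s`_i &
      forall x : O, x \is a GRing.unit <-> ~ pdvd p 1 x].

(* [U] is the union of its finite unramified subextensions, and each finite
   unramified extension of [Zp] embeds into it.                               *)
Definition maximal_unramified (p : nat) (Zp U : idomainType) (a : {rmorphism Zp -> U}) :
    Prop :=
  (forall x : U, exists (O : idomainType) (j : {rmorphism Zp -> O})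
     (e : {rmorphism O -> U}),
     [/\ finite_unramified p j, injective e, e \o j =1 a & exists y, e y = x]) /\
  (forall (O : idomainType) (j : {rmorphism Zp -> O}), finite_unramified p j ->
     exists e : {rmorphism O -> U}, injective e /\ e \o j =1 a).

(* [Zp] is the ring of p-adic integers and [U] the ring of integers of the maximal
   unramified extension of its fraction field.                                *)
Definition is_completed_Zpur (p : nat) (R : idomainType) : Prop :=
  exists (Zp U : idomainType) (a : {rmorphism Zp -> U}) (b : {rmorphism U -> R}),
    [/\ padic_completion p (intmul 1 : {rmorphism int -> Zp}),
        maximal_unramified p a & padic_completion p b].

(* k = R/pR *)
Definition is_residue_field (p : nat) (R : idomainType) (k : fieldType)
    (red : {rmorphism R -> k}) : Prop :=
  (forall y : k, exists x : R, red x = y) /\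
  (forall x : R, red x = 0 <-> pdvd p 1 x).

(* K = R[1/p] *)
Definition is_p_localization (p : nat) (R : idomainType) (K : fieldType)
    (inc : {rmorphism R -> K}) : Prop :=
  injective inc /\
  (forall y : K, exists (x : R) (n : nat), y * p%:R ^+ n = inc x).

Definition is_Frobenius_lift (p : nat) (R : idomainType) (k : fieldType)
    (red : {rmorphism R -> k}) (phi : {rmorphism R -> R}) : Prop :=
  bijective phi /\ forall x : R, red (phi x) = red x ^+ p.

(* An element of R[[q]] (for [neg = false]) or of R[[q^-1]] (for [neg = true])
   is encoded by a power series in t, with t = q, resp. t = q^-1; in particular
   R[q^{+-1}] is {poly R}, and R(q) = R(q^-1) is {fraction {poly R}}.
   [qexp neg n] is the exponent of q in t^n.                                  *)
Definition qexp (neg : bool) (n : nat) : int := (-1) ^+ neg * n%:Z.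

Section Characters.
Variables (p : nat) (R : idomainType) (phi : {rmorphism R -> R}) (neg : bool).
Implicit Types (u : pseries R) (mu : {poly {poly R}}) (kappa : int).

Local Open Scope classical_set_scope.

Definition qsupport u : set int := [set qexp neg n | n in [set n | coefs u n != 0]].

Definition phi_p u : pseries R :=
  PSeries (fun n => if (p %| n)%N then phi (coefs u (n %/ p)%N) else 0).

Definition delta_q u : pseries R := PSeries (fun n => (qexp neg n)%:~R * coefs u n).

(* A polynomial mu(xi_p, xi_q) is an element of {poly {poly R}}: the outer
   variable is xi_p and the inner one is xi_q, so mu_ij = mu`_i`_j.           *)
Definition char_act mu u : pseries R :=
  \sum_(i < size mu) \sum_(j < size mu`_i)
     mu`_i`_j *: iter i phi_p (iter j delta_q u).

Definition eval_mu mu (x y : R) : R := mu.[x%:P].[y].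

Definition nondegenerate_char mu : Prop := eval_mu mu 0 0 \is a GRing.unit.

Definition characteristic_integers mu : set int :=
  [set kappa | eval_mu mu 0 kappa%:~R = 0].

Definition totally_noncharacteristic_integers mu : set int :=
  [set kappa | ~~ (p%:Z %| kappa)%Z /\ ~ pdvd p 1 (eval_mu mu 0 kappa%:~R)].

Definition is_solution mu (varphi u : pseries R) : Prop :=
  [/\ coefs u 0 = 0, char_act mu u = varphi &
      qsupport u `&` characteristic_integers mu = set0].

End Characters.

Definition unmixed (R : idomainType) (k : fieldType) (red : {rmorphism R -> k})
    (mu : {poly {poly R}}) : Prop :=
  (forall i j : nat, (i * j != 0)%N -> red mu`_i`_j = 0) /\
  (exists2 i : nat, i != 0%N & red mu`_i`_0 != 0).

Definition short_pos (p : nat) (S : set int) : Prop :=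
  [/\ finite_set S, forall n, S n -> 0 < n &
      exists m M : int, [/\ S m, S M, forall n, S n -> m <= n <= M &
                           M%:~R / m%:~R < p%:R / 2 :> rat]].

Definition short (p : nat) (S : set int) : Prop :=
  short_pos p S \/ short_pos p [set - n | n in S]%classic.

(* E/F is given by the embedding [j]; F(z)/F is (isomorphic over F to) an abelian
   extension whose Galois group is killed by p.                               *)
Definition abelian_killed_by (p : nat) (F E : fieldType) (j : {rmorphism F -> E})
    (z : E) : Prop :=
  exists (L : splittingFieldType F) (iota : {rmorphism L -> E}) (x : L),
    [/\ forall a : F, iota a%:A = j a, iota x = z & <<1%VS; x>>%VS = fullv] /\
    [/\ galois 1 {:L}, abelian 'Gal({:L} / 1) &
        forall g, g \in 'Gal({:L} / 1)%g -> (g ^+ p = 1)%g].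

(* Main.v *)
Require Import Defs.
From HB Require Import structures.
From mathcomp Require Import all_boot all_order all_algebra all_fingroup all_field.
From mathcomp Require Import boolp classical_sets cardinality.
From mathcomp Require Import cyclic ring zify.

Set Implicit Arguments.
Unset Strict Implicit.
Unset Printing Implicit Defensive.

Import Order.TTheory GRing.Theory Num.Theory.
Local Open Scope ring_scope.

(** Comparing coefficients of t^n, the equation psi u = varphi reads
    mu(0, kappa) u_n + (terms in u_(n/p^i), i > 0) = varphi_n.  The factor
    mu(0, kappa) is a unit of R when p divides n (it is mu(0,0) mod p) and when
    varphi_n <> 0, which gives 1).

    For 2), mu_ij kappa^j vanishes mod p for j > 0 and p | kappa, so
    A(ubar) is a polynomial in t, where A(X) = sum_i mubar_i0 X^(p^i) is additive
    and separable.  Since k is algebraically closed, the other roots of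
    A(X) - A(ubar) are the ubar + a with a in k, A(a) = 0, and the Galois group
    embeds in the F_p-vector space of these a.  That k is algebraically closed is
    proved by building, for each d, the unramified extension of Zp of degree d.

    For 3), an algebraic power series in characteristic 0 is annihilated by a
    linear differential operator over K[t], so its coefficients satisfy a linear
    recurrence with polynomial coefficients, which forbids arbitrarily long gaps
    followed by nonzero coefficients.  The indices of the nonzero coefficients of u
    lie in the blocks [a p^e, b p^e], with 2b < pa, and unmixedness makes
    infinitely many of them nonzero. *)

(** * p-adically complete rings *)

Lemma finType_repeat (T : finType) (f : nat -> T) :
  exists a b : nat, (a < b)%N /\ f a = f b.
Proof.
pose g (i : 'I_#|T|.+1) := f i.
have /injectivePn [i [j ne_ij eq_ij]] : ~~ injectiveb g.
  by apply/negP => /injectiveP/leq_card; rewrite card_ord ltnn.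
case: (ltngtP i j) => lt_ij; [by exists i, j | by exists j, i |].
by rewrite (val_inj lt_ij) eqxx in ne_ij.
Qed.

Lemma pchar_expBn (A : comNzRingType) (p : nat) (charA : p \in [pchar A]) n (x y : A) :
  (x - y) ^+ (p ^ n) = x ^+ (p ^ n) - y ^+ (p ^ n).
Proof.
elim: n => [|n IH]; first by rewrite !expr1.
by rewrite expnSr !exprM IH -!(pFrobenius_autE charA) rmorphB.
Qed.

Lemma pchar_expn_inj (A : idomainType) (p : nat) (charA : p \in [pchar A]) n :
  injective (fun x : A => x ^+ (p ^ n)).
Proof.
move=> x y /= /eqP; rewrite -subr_eq0 -pchar_expBn // expf_eq0 => /andP[_].
by rewrite subr_eq0 => /eqP.
Qed.

(** Frobenius is injective on a domain, so a repetition among its iterates at [x] already makes [x]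
    periodic. *)
Lemma eq_expn_pchar (A : idomainType) (p : nat) (charA : p \in [pchar A]) (x : A) a b :
  (a < b)%N -> x ^+ (p ^ a) = x ^+ (p ^ b) -> x ^+ (p ^ (b - a)) = x.
Proof.
move=> lt_ab eq_x; apply: (pchar_expn_inj charA (n := a)) => /=.
by rewrite -exprM -expnD subnK ?(ltnW lt_ab).
Qed.

Lemma iter_expn (A : comNzRingType) (p d n : nat) (x : A) :
  x ^+ (p ^ d) = x -> x ^+ (p ^ (d * n)) = x.
Proof.
move=> xd; elim: n => [|n IH]; first by rewrite muln0 expr1.
by rewrite mulnS expnD exprM xd.
Qed.

Section PadicRings.
Variable p : nat.

Lemma pdvdD (A : idomainType) n (x y : A) : pdvd p n x -> pdvd p n y -> pdvd p n (x + y).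
Proof. by move=> [a ->] [b ->]; exists (a + b); rewrite mulrDr. Qed.

Lemma pdvdB (A : idomainType) n (x y : A) : pdvd p n x -> pdvd p n y -> pdvd p n (x - y).
Proof. by move=> [a ->] [b ->]; exists (a - b); rewrite mulrBr. Qed.

Lemma pdvdMl (A : idomainType) n (x y : A) : pdvd p n x -> pdvd p n (y * x).
Proof. by move=> [a ->]; exists (y * a); rewrite mulrCA. Qed.

Lemma pdvdMr (A : idomainType) n (x y : A) : pdvd p n x -> pdvd p n (x * y).
Proof. by move=> ?; rewrite mulrC; apply: pdvdMl. Qed.

Lemma pdvd_rmorph (A B : idomainType) (f : {rmorphism A -> B}) n (x : A) :
  pdvd p n x -> pdvd p n (f x).
Proof. by case=> y ->; exists (f y); rewrite rmorphM rmorphXn rmorph_nat. Qed.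

Lemma pdvd0 (A : idomainType) (x : A) : pdvd p 0 x.
Proof. by exists x; rewrite mul1r. Qed.

(** The inverse is the geometric series in [w = p z]. Divisibility is spelled out over a commutative
    ring so that the lemma also serves [{poly %/ h}] before that quotient is known to be a
    domain. *)
Lemma complete_unit (A : comNzRingType) :
    (forall x : A, (forall n, exists y, x = p%:R ^+ n * y) -> x = 0) ->
    (forall f : nat -> A, (forall n, exists y, f n.+1 - f n = p%:R ^+ n * y) ->
        exists l : A, forall n, exists y, l - f n = p%:R ^+ n * y) ->
  forall z : A, exists y, (1 - p%:R * z) * y = 1.
Proof.
move=> sepA complA z; set w := p%:R * z.
have [n|l lP] := complA (fun n => \sum_(i < n) w ^+ i).
  by rewrite big_ord_recr /= addrAC subrr add0r; exists (z ^+ n); rewrite exprMn.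
exists l; apply/eqP; rewrite -subr_eq0; apply/eqP/sepA => n.
have [y yP] := lP n; exists ((1 - w) * y - z ^+ n).
rewrite mulrBr -exprMn -/w mulrCA -yP mulrBr.
have -> : (1 - w) * (\sum_(i < n) w ^+ i) = 1 - w ^+ n.
  by rewrite -opprB mulNr -subrX1 opprB.
by rewrite opprB addrA addrAC addrK.
Qed.

End PadicRings.

(* Carries the structure of [A] together with integrality; needed because the
   quotients of [quotient_unramified] are only shown to be domains inside a proof
   context. *)
Section DomainOfComRing.
Variables (A : comNzRingType).
Hypothesis domA : GRing.integral_domain_axiom A.

Definition domain_of_ring of GRing.integral_domain_axiom A : Type := A.
Local Notation D := (domain_of_ring domA).

HB.instance Definition _ := GRing.ComNzRing.on D.

Definition domain_unit : pred D := fun x => `[< exists y, y * x = 1 >].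
Definition domain_inv (x : D) : D :=
  if pselect (exists y, y * x = 1) is left ex_y then projT1 (cid ex_y) else x.

Fact domain_mulV : {in domain_unit, left_inverse 1 domain_inv *%R}.
Proof.
move=> f /asboolP ex_g; rewrite /domain_inv.
by case: pselect => // ?; case: cid.
Qed.
Fact domain_unitPl (x y : D) : y * x = 1 -> domain_unit x.
Proof. by move=> yx1; apply/asboolP; exists y. Qed.
Fact domain_inv_out : {in [predC domain_unit], domain_inv =1 id}.
Proof.
move=> x /negP nx; rewrite /domain_inv; case: pselect => // ex_y.
by case: nx; apply/asboolP.
Qed.

HB.instance Definition _ := GRing.ComNzRing_hasMulInverse.Build D
  domain_mulV domain_unitPl domain_inv_out.
HB.instance Definition _ := GRing.ComUnitRing_isIntegral.Build D domA.

End DomainOfComRing.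

Lemma rmorphism_of (A B : pzRingType) (f : A -> B) :
  zmod_morphism f -> monoid_morphism f -> exists g : {rmorphism A -> B}, g =1 f.
Proof.
move=> fB fM.
pose g : {rmorphism A -> B} := HB.pack f (GRing.isZmodMorphism.Build A B f fB)
  (GRing.isMonoidMorphism.Build A B f fM).
by exists g.
Qed.

(** The integers are dense in [Zp], and divisibility of an integer by p may be tested in [Zp]; hence
    an integer approximation mod p has a well-defined image in any field of characteristic p. *)
Lemma Zp_residue (p : nat) (Zp : idomainType) (F : fieldType) :
    padic_completion p (intmul 1 : {rmorphism int -> Zp}) -> p \in [pchar F] ->
  exists f : {rmorphism Zp -> F}, forall x, f x = 0 <-> pdvd p 1 x.
Proof.
move=> [_ _ dense faithful] charF.
have intF0 (a : int) : pdvd p 1 (a%:~R : Zp) <-> a%:~R = 0 :> F.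
  split=> [/faithful[c ->]|/eqP].
    by rewrite rmorphM /= rmorphXn /= rmorph_nat (pcharf0 charF) mul0r.
  rewrite -(dvdz_pcharf charF) => /dvdzP[c ->].
  by exists c%:~R; rewrite expr1 rmorphM /= mulrC.
pose f x : F := (projT1 (cid (dense x 1%N)))%:~R.
have fE x (a : int) : pdvd p 1 (x - a%:~R) -> f x = a%:~R.
  rewrite /f; case: cid => /= c xc xa; apply/eqP; rewrite -subr_eq0 -rmorphB /=.
  apply/eqP/intF0; rewrite rmorphB /=.
  have -> : c%:~R - a%:~R = (x - a%:~R) - (x - c%:~R) :> Zp.
    by ring.
  exact: pdvdB.
have fP x : exists2 a : int, pdvd p 1 (x - a%:~R) & f x = a%:~R.
  by have [a xa] := dense x 1%N; exists a; rewrite ?(fE x a).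
have fB : zmod_morphism f.
  move=> x y; have [a xa ->] := fP x; have [b yb ->] := fP y.
  rewrite -rmorphB /=; apply: fE; rewrite rmorphB /=.
  have -> : x - y - (a%:~R - b%:~R) = (x - a%:~R) - (y - b%:~R) by ring.
  exact: pdvdB.
have fM : monoid_morphism f.
  split=> [|x y].
    by rewrite (fE 1 1) ?rmorph1 // subrr; exists 0; rewrite mulr0.
  have [a xa ->] := fP x; have [b yb ->] := fP y.
  rewrite -rmorphM /=; apply: fE; rewrite rmorphM /=.
  have -> : x * y - a%:~R * b%:~R = x * (y - b%:~R) + (x - a%:~R) * b%:~R.
    by ring.
  by apply: pdvdD; [apply: pdvdMl | apply: pdvdMr].
have [g gE] := rmorphism_of fB fM; exists g => x; rewrite gE.
have [a xa fa] := fP x; split=> [f0 | x0].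
  rewrite -(subrK a%:~R x); apply: pdvdD => //; apply/intF0.
  by rewrite -fa.
by rewrite (fE x 0) ?rmorph0 ?subr0.
Qed.

(** * Unramified extensions and the residue field *)

(* f(x)^(#|F| - 1) = 1, so x^(#|F| - 1) = 1 - p z, which is inverted by a geometric
   series. *)
Lemma complete_lift_unit (p : nat) (A : comNzRingType) (F : finFieldType)
    (f : {rmorphism A -> F}) :
    (forall x : A, (forall n, exists y, x = p%:R ^+ n * y) -> x = 0) ->
    (forall u : nat -> A, (forall n, exists y, u n.+1 - u n = p%:R ^+ n * y) ->
        exists l : A, forall n, exists y, l - u n = p%:R ^+ n * y) ->
    (forall x, f x = 0 -> exists y, x = p%:R * y) ->
  forall x, f x != 0 -> exists y, x * y = 1.
Proof.
move=> sepA complA kerf x fx0.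
have /kerf[z xz] : f (1 - x ^+ #|F|.-1) = 0.
  rewrite rmorphB rmorph1 rmorphXn /=; apply/eqP; rewrite subr_eq0 eq_sym; apply/eqP.
  by apply: (mulfI fx0); rewrite -exprS prednK ?mulr1 ?expf_card // ltnW ?finNzRing_gt1.
have [y yz] := complete_unit sepA complA z.
exists (x ^+ #|F|.-2 * y); rewrite -[RHS]yz -xz subKr mulrA -exprS.
by rewrite prednK // -ltnS prednK ?finNzRing_gt1 // ltnW ?finNzRing_gt1.
Qed.

(* Zp[X]/(h), where h is a monic lift of minimal degree of an annihilator of a
   generator theta of F^*; evaluation at theta has kernel generated by p. *)
Section UnramifiedExtension.
Variables (p : nat) (Zp : idomainType) (F : finFieldType) (f : {rmorphism Zp -> F}).
Hypothesis sepZp : forall x : Zp, (forall n, pdvd p n x) -> x = 0.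
Hypothesis complZp : forall u : nat -> Zp, (forall n, pdvd p n (u n.+1 - u n)) ->
        exists l : Zp, forall n, pdvd p n (l - u n).
Hypothesis p_neq0 : p%:R != 0 :> Zp.
Hypothesis kerf : forall x, f x = 0 <-> pdvd p 1 x.
Variables (h : {poly Zp}) (theta : F).
Hypothesis monh : h \is monic.
Hypothesis h_theta : (map_poly f h).[theta] = 0.
Hypothesis minh : forall g : {poly Zp},
  g \is monic -> (map_poly f g).[theta] = 0 -> (size h <= size g)%N.
Hypothesis gen_theta : forall y : F, y != 0 -> exists i, y = theta ^+ i.

Let size_h : (1 < size h)%N.
Proof.
rewrite ltnNge; apply/negP => /size1_polyC hE; move/eqP: h_theta.
have /monicP := monh; rewrite hE lead_coefC => ->.
by rewrite rmorph1 hornerC oner_eq0.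
Qed.

Let O := {poly %/ h}.

Let mkh : mk_monic h = h.
Proof. by rewrite /mk_monic size_h monh. Qed.

(** If the reduction were nonzero, truncating [a] at the degree of that reduction and dividing by
    the leading coefficient, a unit of [Zp], would give a monic annihilator of [theta] smaller than
    [h]. *)
Let small_ker (a : {poly Zp}) : (size a < size h)%N ->
  (map_poly f a).[theta] = 0 -> map_poly f a = 0.
Proof.
move=> lt_ah a_theta; apply/eqP/negP => /negP nz_a.
set m := size (map_poly f a).
have m_gt0 : (0 < m)%N by rewrite size_poly_gt0.
pose b := \poly_(i < m) a`_i.
have fb : map_poly f b = map_poly f a.
  apply/polyP => i; rewrite !coef_map coef_poly; case: ltnP => // le_mi.
  by rewrite raddf0 -coef_map nth_default.
have fl : f a`_m.-1 != 0.
  by move: nz_a; rewrite -lead_coef_eq0 lead_coefE -/m coef_map.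
have nz_l : a`_m.-1 != 0.
  by apply: contraNneq fl => ->; rewrite rmorph0.
have [|y ly] := complete_lift_unit sepZp complZp _ fl.
  by move=> x /kerf.
have nz_y : y != 0 by apply: contra_eq_neq ly => ->; rewrite mulr0 eq_sym oner_eq0.
have szb : size b = m by rewrite size_poly_eq.
have := minh (g := y *: b); rewrite monicE lead_coefZ lead_coefE szb coef_poly.
rewrite prednK // leqnn mulrC ly eqxx map_polyZ hornerZ fb a_theta mulr0.
move=> /(_ isT erefl); rewrite size_scale // szb leqNgt.
by rewrite (leq_ltn_trans (size_poly _ _) lt_ah).
Qed.

Let rho_fun (x : O) : F := (map_poly f x).[theta].

Let rho_in q : rho_fun (in_qpoly h q) = (map_poly f q).[theta].
Proof.
rewrite /rho_fun /= mkh [q in RHS](Pdiv.RingMonic.rdivp_eq monh).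
by rewrite rmorphD rmorphM /= hornerD hornerM h_theta mulr0 add0r.
Qed.

Let rhoB : zmod_morphism rho_fun.
Proof. by move=> x y; rewrite /rho_fun /= rmorphB /= hornerD hornerN. Qed.

Let rhoM : monoid_morphism rho_fun.
Proof.
split=> [|x y]; first by rewrite -in_qpoly1 rho_in rmorph1 hornerC.
have -> : x * y = in_qpoly h ((x : {poly Zp}) * (y : {poly Zp})) by [].
by rewrite rho_in rmorphM /= hornerM.
Qed.

Let coef_pn n (x : O) i : (p%:R ^+ n * x : O)`_i = p%:R ^+ n * x`_i.
Proof.
rewrite -natrX mulr_natl -[in RHS]natrX [RHS]mulr_natl.
have -> m : polyn (x *+ m) = polyn x *+ m.
  by elim: m => // m IH; rewrite !mulrS -IH.
by rewrite coefMn.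
Qed.

Let divP n (x : O) : (forall i, pdvd p n x`_i) -> exists y, x = p%:R ^+ n * y.
Proof.
case/choice=> y xy; exists (mk_npoly _ y); apply/npolyP => i.
rewrite coef_pn coef_poly; case: ltnP => // le_i.
by rewrite mulr0 big_coef_npoly.
Qed.

Let sepO (x : O) : (forall n, exists y, x = p%:R ^+ n * y) -> x = 0.
Proof.
move=> x0; apply/npolyP => i; rewrite coef0; apply: sepZp => n.
by have [y ->] := x0 n; exists y`_i; rewrite coef_pn.
Qed.

Let complO (u : nat -> O) : (forall n, exists y, u n.+1 - u n = p%:R ^+ n * y) ->
  exists l : O, forall n, exists y, l - u n = p%:R ^+ n * y.
Proof.
move=> uC; have /choice[l lP] i : exists l, forall n, pdvd p n (l - (u n)`_i).
  apply: complZp => n; have [y /(congr1 (fun z : O => z`_i))] := uC n.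
  by rewrite coef_pn /= coefB => ->; exists y`_i.
exists (mk_npoly _ l) => n; apply: divP => i.
rewrite coefB coef_poly; case: ltnP => // le_i.
by rewrite big_coef_npoly // subr0; exists 0; rewrite mulr0.
Qed.

Let ker_rho (x : O) : rho_fun x = 0 -> exists y, x = p%:R * y.
Proof.
move/small_ker=> x0; apply: (divP (n := 1%N)) => i; apply/kerf.
by rewrite -coef_map x0 ?coef0 // -[in leqRHS]mkh size_mk_monic.
Qed.

Let invO (x : O) : rho_fun x != 0 -> exists y, x * y = 1.
Proof.
have [rho rhoE] := rmorphism_of rhoB rhoM.
rewrite -rhoE; apply: complete_lift_unit; [exact: sepO | exact: complO|].
by move=> z; rewrite rhoE => /ker_rho.
Qed.

(** A nonzero [x] is [p^n z] with [z] not divisible by p; then [z] is invertible, and [p^n] is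
    cancelled coefficientwise in [Zp]. *)
Let domO : GRing.integral_domain_axiom O.
Proof.
move=> x y xy0; case: eqVneq => //= nz_x.
have ex_n : exists n, `[< ~ exists z, x = p%:R ^+ n * z >].
  apply: contrapT => no_n; case/eqP: nz_x; apply: sepO => n.
  by apply: contrapT => nx; case: no_n; exists n; apply/asboolP.
case: (ex_minnP ex_n) => -[|n] /asboolP nx minn.
  by case: nx; exists x; rewrite mul1r.
have [z xz] : exists z, x = p%:R ^+ n * z.
  by apply: contrapT => nxn; have := minn n; rewrite ltnn => /(_ (asboolT nxn)).
have [|w zw1] := @invO z.
  apply/eqP => /ker_rho[w zw]; case: nx; exists w.
  by rewrite xz {}zw mulrA -exprSr.
suffices zy0 : z * y = 0 by rewrite -[y]mul1r -zw1 mulrAC zy0 mul0r.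
apply/npolyP => i; rewrite coef0; apply/eqP.
have /eqP : p%:R ^+ n * (z * y)`_i = 0 by rewrite -coef_pn mulrA -xz xy0 coef0.
by rewrite mulf_eq0 expf_eq0 (negPf p_neq0) andbF.
Qed.

Lemma quotient_unramified : exists (O : idomainType) (j : {rmorphism Zp -> O})
    (rho : {rmorphism O -> F}),
  [/\ finite_unramified p j, forall y, exists x, rho x = y
    & forall x, rho x = 0 -> pdvd p 1 x].
Proof.
pose D : idomainType := domain_of_ring domO.
pose j : {rmorphism Zp -> D} := in_qpoly h \o polyC.
have [rho rhoE] := @rmorphism_of D F _ rhoB rhoM.
exists D, j, rho; split=> [|y|x]; last by rewrite rhoE => /ker_rho.
- have jE c : polyn (j c) = c%:P.
    by apply: in_qpoly_small; rewrite mkh (leq_ltn_trans (size_polyC_leq1 _)).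
  split=> [a b /(congr1 (@polyn _ _))|| x].
  + by rewrite !jE => /polyC_inj.
  + exists (mkseq (fun i => in_qpoly h 'X^i) (size h).-1) => x.
    exists (fun i => (x : O)`_i); rewrite size_mkseq.
    rewrite -[LHS](_ : in_qpoly h (\poly_(i < (size h).-1) (x : O)`_i) = x).
      rewrite poly_def raddf_sum; apply: eq_bigr => i _.
      by rewrite nth_mkseq //= -mul_polyC [LHS](rmorphM (in_qpoly h)).
    apply: val_inj; rewrite /= Pdiv.CommonRing.rmodp_small.
      apply/polyP=> i; rewrite coef_poly; case: ltnP => // le_i.
      by rewrite big_coef_npoly ?mkh.
    by apply: leq_ltn_trans (size_poly _ _) _; rewrite mkh prednK // ltnW.
  + split=> [ux | nx].
      case/(pdvd_rmorph rho)=> y; have -> : p%:R = 0 :> F.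
        by rewrite -(rmorph_nat f); apply/kerf; exists 1; rewrite mulr1.
      by rewrite mul0r => x0; have := rmorph_unit rho ux; rewrite x0 unitr0.
    have [|y xy] := @invO x; last by apply/unitrPr; exists y.
    by apply/eqP => /ker_rho[y xy]; case: nx; exists y; rewrite expr1.
have [->|/gen_theta[i ->]] := eqVneq y 0; first by exists 0; rewrite rmorph0.
by exists (in_qpoly h 'X^i); rewrite rhoE rho_in map_polyXn hornerXn.
Qed.

End UnramifiedExtension.

Lemma unit_group_generator (F : finFieldType) :
  exists2 theta : F, forall y : F, y != 0 -> exists i, y = theta ^+ i
    & theta ^+ #|F|.-1 = 1.
Proof.
have /cyclicP[g gE] := field_unit_group_cyclic [set: {unit F}]%G.
exists (val g) => [y nz_y|].
  have : finField_unit nz_y \in <[g]>%g by rewrite -gE inE.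
  by case/cycleP=> i /(congr1 val) /=; rewrite FinRing.val_unitX; exists i.
by rewrite -card_finField_unit -FinRing.val_unitX (@expg_cardG _ [set: {unit F}]%G) ?inE.
Qed.

(** Otherwise p^2 would divide p in [Zp], hence in the integers. *)
Lemma Zp_nat_neq0 (p : nat) (Zp : idomainType) : prime p ->
    padic_completion p (intmul 1 : {rmorphism int -> Zp}) ->
  p%:R != 0 :> Zp.
Proof.
move=> p_pr [_ _ _ faithful]; apply/eqP => p0.
have [|y] := faithful p%:Z 2%N; first by rewrite /= -pmulrn p0; exists 0; rewrite mulr0.
move/(congr1 absz); rewrite abszM -natrX natz !absz_nat => py.
have : (p ^ 2 %| p)%N by rewrite {2}py dvdn_mulr.
by rewrite gtnNdvd ?prime_gt0 // -{1}(expn1 p) ltn_exp2l ?prime_gt1.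
Qed.

Lemma exists_unramified (p d : nat) (Zp : idomainType) : prime p -> (0 < d)%N ->
    padic_completion p (intmul 1 : {rmorphism int -> Zp}) ->
  exists (F : finFieldType) (O : idomainType) (j : {rmorphism Zp -> O})
    (rho : {rmorphism O -> F}),
  [/\ #|F| = (p ^ d)%N, finite_unramified p j, forall y, exists x, rho x = y
    & forall x, rho x = 0 -> pdvd p 1 x].
Proof.
move=> p_pr d_gt0 Zp_def; have [F charF oF] := pPrimePowerField p_pr d_gt0.
have [f kerf] := Zp_residue Zp_def charF.
have [theta gen_theta theta1] := unit_group_generator F.
pose P n := `[< exists g : {poly Zp},
  [/\ g \is monic, (map_poly f g).[theta] = 0 & size g = n] >].
have n_gt0 : (0 < #|F|.-1)%N by rewrite -ltnS prednK ?finNzRing_gt1 // ltnW ?finNzRing_gt1.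
have exP : exists n, P n.
  (* [X^(#|F|-1) - 1] kills [theta], so a monic annihilator of minimal size exists. *)
  exists #|F|.-1.+1; apply/asboolP; exists ('X^(#|F|.-1) - 1%:P).
  rewrite monicXnsubC // size_XnsubC // rmorphB /= map_polyXn map_polyC /=.
  by rewrite !hornerE theta1 rmorph1 subrr.
case: (ex_minnP exP) => n /asboolP[h [monh h0 szh]] minn.
have [sep compl _ _] := Zp_def.
have [|O [j [rho [? ? ?]]]] := quotient_unramified sep compl (Zp_nat_neq0 p_pr Zp_def)
  kerf monh h0 _ gen_theta.
  by move=> g mong g0; rewrite szh; apply: minn; apply/asboolP; exists g.
by exists F, O, j, rho.
Qed.

(** * The residue field is algebraic over its prime field and algebraically closed *)

Section ResidueField.
Variables (p : nat) (R : idomainType) (k : fieldType) (red : {rmorphism R -> k}).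
Hypothesis p_prime : prime p.
Hypothesis R_def : is_completed_Zpur p R.
Hypothesis k_def : is_residue_field p red.

Let red0 x : pdvd p 1 x -> red x = 0. Proof. by case: k_def => _ /(_ x)[]. Qed.

Lemma residue_pchar : p \in [pchar k].
Proof.
rewrite inE p_prime -(rmorph_nat red) red0 ?eqxx //.
by exists 1; rewrite mulr1.
Qed.

(** Modulo p, a lift of [y] comes from a finite layer [O]. Since [O] is finitely generated over
    [Zp], and [Zp] maps into the prime field, the image of [O] in [k] is finite; so the powers
    [y ^+ (p ^ n)] repeat. *)
Lemma residue_periodic (y : k) : exists2 d, (0 < d)%N & y ^+ (p ^ d) = y.
Proof.
have [surj _] := k_def; have [x <-] := surj y.
have [Zp [U [a [b [Zp_def [Uur _] [_ _ denseU _]]]]]] := R_def.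
have [w xw] := denseU x 1%N.
have [O [j [e [[_ [s gen_s] _] _ _ [o ow]]]]] := Uur w.
pose m := size s.
pose tau : {rmorphism O -> k} := red \o (b \o e).
have xE : red x = tau o.
  by apply/eqP; rewrite -subr_eq0 /= -rmorphB ow; apply/eqP/red0.
have tauZ (c : Zp) : exists i : 'I_p, tau (j c) = i%:R.
  have [_ _ denseZ _] := Zp_def; have [z zc] := denseZ c 1%N.
  have p_gt0 := prime_gt0 p_prime.
  have : (`|(z %% p)%Z| < p)%N.
    by rewrite -ltz_nat gez0_abs ?modz_ge0 ?ltz_pmod //; case: (p) p_gt0.
  move=> lt_zp; exists (Ordinal lt_zp); transitivity (tau (j z%:~R)).
    apply/eqP; rewrite -subr_eq0 -!rmorphB; apply/eqP/red0.
    by do !apply: pdvd_rmorph.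
  rewrite !rmorph_int {1}(divz_eq z p) rmorphD rmorphM /= -!pmulrn.
  rewrite (pcharf0 residue_pchar) mulr0 add0r pmulrn gez0_abs ?modz_ge0 //.
  by case: (p) p_gt0.
have tau_fin o' : exists c : {ffun 'I_m -> 'I_p}, tau o' = \sum_i (c i)%:R * tau s`_i.
  have [c ->] := gen_s o'.
  have /choice[g gE] (i : 'I_m) := tauZ (c i).
  exists (finfun g); rewrite rmorph_sum; apply: eq_bigr => i _.
  by rewrite ffunE rmorphM gE.
have /choice[c cE] := fun n => tau_fin (o ^+ (p ^ n)).
have [n1 [n2 [lt_n eq_c]]] := finType_repeat c.
exists (n2 - n1)%N; first by rewrite subn_gt0.
by rewrite xE; apply: (eq_expn_pchar residue_pchar lt_n); rewrite -!rmorphXn !cE eq_c.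
Qed.

(** An unramified extension [O] with residue field [F] embeds into [U], hence maps to [k]; the
    kernel of [rho] lies in [pO], so this map factors through [F]. *)
Lemma residue_subfield d : (0 < d)%N ->
  exists F : finFieldType, #|F| = (p ^ d)%N /\ inhabited {rmorphism F -> k}.
Proof.
move=> d_gt0; have [Zp [U [a [b [Zp_def [_ embU] _]]]]] := R_def.
have [F [O [j [rho [oF Our surj ker]]]]] := exists_unramified p_prime d_gt0 Zp_def.
exists F; split=> //; have [e [_ _]] := embU O j Our.
pose tau : {rmorphism O -> k} := red \o (b \o e).
have tau_eq x y : rho x = rho y -> tau x = tau y.
  move/eqP; rewrite -subr_eq0 -rmorphB => /eqP/ker xy.
  by apply/eqP; rewrite -subr_eq0 -rmorphB; apply/eqP/red0; by do !apply: pdvd_rmorph.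
have /choice[l lE] := surj.
pose g y := tau (l y).
have [||g' _] := @rmorphism_of F k g; last by constructor.
  by move=> x y; rewrite /g -[RHS]rmorphB; apply: tau_eq; rewrite rmorphB !lE.
split=> [|x y]; first by rewrite -(rmorph1 tau); apply: tau_eq; rewrite lE rmorph1.
by rewrite /g -[RHS]rmorphM; apply: tau_eq; rewrite rmorphM !lE.
Qed.

Let genPoly_split d : (0 < d)%N ->
  exists rs : seq k, 'X^(p ^ d) - 'X = \prod_(z <- rs) ('X - z%:P).
Proof.
case/residue_subfield=> F [oF [sigma]]; exists [seq sigma y | y <- enum F].
have := congr1 (map_poly sigma) (finField_genPoly F).
rewrite rmorphB /= map_polyXn map_polyX oF rmorph_prod big_map big_enum /= => ->.
by apply: eq_bigr => z _; rewrite rmorphB /= map_polyX map_polyC.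
Qed.

(** The coefficients of [A] lie in the image of a finite field [F], so [A] comes from some [B] over
    [F]. There are finitely many remainders mod [B], so two powers [X^(p^n)] agree mod [B], and [B]
    divides a power of some [X^(p^d) - X], which splits over [k]. *)
Lemma residue_split (A : {poly k}) : A != 0 ->
  exists rs : seq k, A %= \prod_(z <- rs) ('X - z%:P).
Proof.
move=> nz_A.
have /choice[d dP] (i : nat) : exists d, (0 < d)%N /\ A`_i ^+ (p ^ d) = A`_i.
  by have [d] := residue_periodic A`_i; exists d.
(* A common multiple of the periods of all coefficients. *)
pose D := \prod_(i < size A) d i.
have D_gt0 : (0 < D)%N by rewrite prodn_gt0 // => i; case: (dP i).
have AD i : A`_i ^+ (p ^ D) = A`_i.
  have [lt_i|le_i] := ltnP i (size A); last first.
    by rewrite nth_default // expr0n expn_eq0 -leqn0 leqNgt prime_gt0.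
  rewrite /D (bigD1 (Ordinal lt_i)) //=.
  by apply: iter_expn; case: (dP i).
have [F [oF [sigma]]] := residue_subfield D_gt0.
have charF : p \in [pchar F] := card_finPcharP oF p_prime.
have preim (y : k) : y ^+ (p ^ D) = y -> exists z, sigma z = y.
  move=> yD; have := congr1 (map_poly sigma) (finField_genPoly F).
  rewrite rmorphB /= map_polyXn map_polyX oF rmorph_prod /=.
  move/(congr1 (fun q : {poly k} => q.[y])); rewrite !hornerE yD subrr.
  rewrite horner_prod => /esym/eqP; rewrite prodf_seq_eq0 => /hasP[z _] /=.
  by rewrite rmorphB /= map_polyX map_polyC hornerXsubC subr_eq0 => /eqP ->; exists z.
have /choice[c cE] : forall i, exists z, sigma z = A`_i by move=> i; apply/preim/AD.
pose B := \poly_(i < size A) c i.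
have BE : map_poly sigma B = A.
  apply/polyP=> i; rewrite coef_map coef_poly /=.
  by case: ltnP => [_|le_i]; rewrite ?cE // rmorph0 nth_default.
have nz_B : B != 0 by apply: contraNneq nz_A => B0; rewrite -BE B0 rmorph0.
have [n1 [n2 [lt_n eq_mod]]] :
    exists n1 n2 : nat, (n1 < n2)%N /\ 'X^(p ^ n1) %% B = 'X^(p ^ n2) %% B.
  pose f n : {poly_(size B) F} := npolyp (size B) ('X^(p ^ n) %% B).
  have [n1 [n2 [lt_n /(congr1 (@polyn _ _))]]] := finType_repeat f.
  rewrite !npolypK ?(ltnW (ltn_modpN0 _ nz_B)) // => eq_mod.
  by exists n1, n2.
have dvdB : B %| ('X^(p ^ (n2 - n1)) - 'X) ^+ (p ^ n1).
  have charFX : p \in [pchar {poly F}] by rewrite pchar_poly.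
  rewrite (pchar_expBn charFX) -exprM -expnD subnK 1?ltnW //.
  by rewrite /dvdp modpD modpN eq_mod subrr.
have [rs rsE] := genPoly_split (d := (n2 - n1)%N) (etrans (subn_gt0 _ _) lt_n).
have := dvdB; rewrite -(dvdp_map sigma) BE rmorphXn rmorphB /= map_polyXn map_polyX rsE.
rewrite -prodrXl.
have -> : \prod_(z <- rs) ('X - z%:P) ^+ (p ^ n1) =
    \prod_(z <- flatten (nseq (p ^ n1) rs)) ('X - z%:P).
  elim: (p ^ n1)%N => [|n IH] /=; first by rewrite big_nil big1.
  by rewrite big_cat /= -IH; under eq_bigr do rewrite exprS; rewrite big_split.
by case/dvdp_prod_XsubC=> m Am; exists (mask m (flatten (nseq (p ^ n1) rs))).
Qed.

End ResidueField.

(** * The recursion for the coefficients of a solution *)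

Section CompletedUnramified.
Variables (p : nat) (R : idomainType) (k : fieldType) (red : {rmorphism R -> k}).
Hypothesis p_prime : prime p.
Hypothesis R_def : is_completed_Zpur p R.
Hypothesis k_def : is_residue_field p red.

Lemma completed_sep (x : R) : (forall n, pdvd p n x) -> x = 0.
Proof. by case: R_def => ? [? [? [? [_ _ [sepR _ _ _]]]]]; apply: sepR. Qed.

(** Lifting the inverse of [red x] gives [x y = 1 - p z], which is invertible by completeness. *)
Lemma red_unit (x : R) : (x \is a GRing.unit) = (red x != 0).
Proof.
apply/idP/idP => [/(rmorph_unit red)|nz_x]; first by rewrite unitfE.
have [_ [_ [_ [_ [_ _ [sepR complR _ _]]]]]] := R_def.
have [surj ker] := k_def; have [y xy] := surj (red x)^-1.
have /ker[z zE] : red (1 - x * y) = 0.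
  by rewrite rmorphB rmorph1 rmorphM /= xy mulfV // subrr.
have [w wE] := complete_unit sepR complR z.
apply/unitrPr; exists (y * w); rewrite mulrA -[RHS]wE; congr (_ * w).
by rewrite -[p%:R * z]zE subKr.
Qed.

(** If p were 0 in [R], then p^2 would divide p in [U], so p would divide 1 there; the finite layer
    containing the quotient would then have a unit divisible by p. *)
Lemma completed_p_neq0 : p%:R != 0 :> R.
Proof.
have [Zp [U [a [b [Zp_def [Uur _] [_ _ _ faithful]]]]]] := R_def.
apply/eqP => p0.
have [O [j [e [[injj _ unitO] inje eja _]]]] := Uur 0.
have nz_pU : p%:R != 0 :> U.
  rewrite -(rmorph_nat e) -(rmorph_nat j) -(rmorph0 e) -(rmorph0 j).
  by rewrite (inj_eq inje) (inj_eq injj) Zp_nat_neq0.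
have [|y py] := faithful p%:R 2%N.
  by rewrite rmorph_nat p0; exists 0; rewrite mulr0.
have py1 : 1 = p%:R * y.
  by apply: (mulfI nz_pU); rewrite mulr1 {1}py expr2 mulrA.
have [O' [j' [e' [[_ _ unitO'] inje' _ [y' y'E]]]]] := Uur y.
have : ~ pdvd p 1 (1 : O') by apply/unitO'/unitr1.
by case; exists y'; apply: inje'; rewrite rmorphM rmorphXn rmorph_nat rmorph1 y'E.
Qed.

Lemma red_nat_eq0 n : (red n%:R == 0) = (p %| n)%N.
Proof. by rewrite rmorph_nat (dvdn_pcharf (residue_pchar p_prime k_def)). Qed.

Lemma completed_pchar0 n : (n%:R == 0 :> R) = (n == 0)%N.
Proof.
apply/idP/idP => [|/eqP->] //; apply: contraTT; rewrite -lt0n => n_gt0.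
rewrite -(partnC p n_gt0) p_part natrM natrX mulf_neq0 ?expf_neq0 ?completed_p_neq0 //.
have : red (n`_p^')%:R != 0.
  by rewrite red_nat_eq0 -prime_coprime // coprime_sym; apply: (@p'nat_coprime p); rewrite ?part_pnat ?pnat_id.
by apply: contraNneq => ->; rewrite rmorph0.
Qed.

End CompletedUnramified.

Section Recursion.
Variables (p : nat) (R : idomainType) (phi : {rmorphism R -> R}) (neg : bool).
Hypothesis p_gt1 : (1 < p)%N.
Implicit Types (u : pseries R) (mu : {poly {poly R}}).

Lemma coefs_sum (A : idomainType) (I : Type) (r : seq I) (P : pred I)
    (f : I -> pseries A) n :
  coefs (\sum_(i <- r | P i) f i) n = \sum_(i <- r | P i) coefs (f i) n.
Proof. exact: (big_morph (fun u : pseries A => coefs u n)). Qed.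

(** The eigenvalue on [t^n] of the coefficient of [xi_p^i] in [mu], with [xi_q] acting as
    [delta_q]. *)
Definition char_coef mu i n : R := (mu`_i).[(qexp neg n)%:~R].

Lemma eval_mu_char_coef mu n : eval_mu mu 0 (qexp neg n)%:~R = char_coef mu 0 n.
Proof. by rewrite /eval_mu polyC0 horner_coef0. Qed.

Lemma coefs_iter_phi_p i u n :
  coefs (iter i (phi_p p phi) u) n =
    if (p ^ i %| n)%N then iter i phi (coefs u (n %/ p ^ i)%N) else 0.
Proof.
elim: i n => [|i IH] n; first by rewrite dvd1n divn1.
rewrite /= IH; case: ifP => [p_n|/negP np_n]; last first.
  by case: ifP => // dvd_n; case: np_n; apply: dvdn_trans dvd_n; rewrite expnS dvdn_mulr.
rewrite expnS divnMA dvdn_divRL // mulnC.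
by case: ifP => // _; rewrite rmorph0.
Qed.

Lemma coefs_iter_delta_q j u n :
  coefs (iter j (delta_q neg) u) n = (qexp neg n)%:~R ^+ j * coefs u n.
Proof.
by elim: j => [|j IH]; rewrite ?mul1r // exprS -mulrA -IH.
Qed.

Lemma iter_rmorph_int i (a : int) j (x : R) :
  iter i phi (a%:~R ^+ j * x) = a%:~R ^+ j * iter i phi x.
Proof. by elim: i => //= i ->; rewrite rmorphM rmorphXn /= rmorph_int. Qed.

Lemma iter_rmorph0 i : iter i phi 0 = 0.
Proof. by elim: i => //= i ->; rewrite rmorph0. Qed.

Definition char_tail mu u n : R :=
  \sum_(1 <= i < size mu | (p ^ i %| n)%N)
    char_coef mu i (n %/ p ^ i)%N * iter i phi (coefs u (n %/ p ^ i)%N).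

(** [delta_q] acts before [phi_p], so its eigenvalue is taken at [n / p^i]; being an integer, it is
    fixed by [phi]. *)
Lemma coefs_char_act_sum mu u n :
  coefs (char_act p phi neg mu u) n = \sum_(i < size mu | (p ^ i %| n)%N)
    char_coef mu i (n %/ p ^ i)%N * iter i phi (coefs u (n %/ p ^ i)%N).
Proof.
rewrite /char_act coefs_sum [RHS]big_mkcond; apply: eq_bigr => i _.
rewrite coefs_sum /=; under eq_bigr do rewrite coefs_iter_phi_p coefs_iter_delta_q.
case: ifP => _; last by rewrite big1 // => j _; rewrite mulr0.
under eq_bigr do rewrite iter_rmorph_int mulrA.
by rewrite -mulr_suml -horner_coef.
Qed.

Lemma coefs_char_act mu u n : mu != 0 ->
  coefs (char_act p phi neg mu u) n = char_coef mu 0 n * coefs u n + char_tail mu u n.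
Proof.
move=> nz_mu; rewrite coefs_char_act_sum /char_tail.
rewrite -(big_mkord (fun i => p ^ i %| n)%N (fun i => char_coef mu i (n %/ p ^ i)%N *
  iter i phi (coefs u (n %/ p ^ i)%N))).
by rewrite big_ltn_cond ?size_poly_gt0 // expn0 dvd1n divn1.
Qed.

Lemma divn_pexp_lt i n : (0 < i)%N -> (0 < n)%N -> (n %/ p ^ i < n)%N.
Proof. by move=> i_gt0 n_gt0; rewrite ltn_Pdiv // -(expn0 p) ltn_exp2l. Qed.

Lemma eq_char_tail mu u v n : (0 < n)%N ->
  (forall m, (m < n)%N -> coefs u m = coefs v m) -> char_tail mu u n = char_tail mu v n.
Proof.
move=> n_gt0 eq_uv; rewrite /char_tail big_nat_cond [RHS]big_nat_cond; apply: eq_bigr => i.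
by case/andP => /andP[i_gt0 _] _; rewrite eq_uv // divn_pexp_lt.
Qed.

Lemma char_tail0 mu u n : ~~ (p %| n)%N -> char_tail mu u n = 0.
Proof.
move=> np_n; rewrite /char_tail big_nat_cond big1 // => -[|i] /andP[/andP[// _ _]] dvd_n.
by case/negP: np_n; apply: dvdn_trans dvd_n; rewrite expnS dvdn_mulr.
Qed.

Lemma solution_at0 mu u : coefs u 0 = 0 -> coefs (char_act p phi neg mu u) 0 = 0.
Proof.
move=> u0; rewrite /char_act coefs_sum big1 // => i _.
rewrite coefs_sum big1 // => j _ /=.
by rewrite coefs_iter_phi_p coefs_iter_delta_q div0n u0 mulr0 iter_rmorph0 if_same mulr0.
Qed.

Section FixedPoint.
Variables (mu : {poly {poly R}}) (varphi : pseries R).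

(** Coefficients at which division is impossible are set to 0. For a non-degenerate character and
    [varphi] supported on totally non-characteristic integers, such an [n > 0] is prime to p and
    [varphi_n = 0], so the equation still holds there. *)
Definition solution_step u : pseries R :=
  PSeries (fun n => if (n == 0)%N || (char_coef mu 0 n \isn't a GRing.unit) then 0 else
    (coefs varphi n - char_tail mu u n) / char_coef mu 0 n).

(* Coefficient n of [solution_step u] only depends on coefficients of u of smaller
   index, so n + 1 iterations compute it. *)
Definition char_solution : pseries R :=
  PSeries (fun n => coefs (iter n.+1 solution_step 0) n).

Lemma solution_stepE : solution_step char_solution = char_solution.
Proof.
have stab N n : (n < N)%N -> coefs (iter N solution_step 0) n = coefs char_solution n.
  elim/ltn_ind: n N => n IH [] // N; rewrite ltnS /= => le_nN.
  case: eqVneq => //= n_neq0; case: ifP => // _.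
  congr ((_ - _) / _); apply: eq_char_tail; rewrite ?lt0n // => m lt_mn.
  by rewrite !IH // (leq_trans lt_mn).
apply: pseriesP => n /=; case: eqVneq => //= n_neq0; case: ifP => // _.
congr ((_ - _) / _); apply: eq_char_tail; rewrite ?lt0n // => m lt_mn.
by rewrite -(stab n).
Qed.

End FixedPoint.
End Recursion.

(** * Existence and uniqueness of the solution *)

Section SolutionTheory.
Variables (p : nat) (R : idomainType) (k : fieldType) (red : {rmorphism R -> k}).
Hypothesis p_prime : prime p.
Hypothesis R_def : is_completed_Zpur p R.
Hypothesis k_def : is_residue_field p red.
Variables (phi : {rmorphism R -> R}) (mu : {poly {poly R}}) (neg : bool).
Hypothesis mu_nondeg : nondegenerate_char mu.
Variable varphi : pseries R.
Hypothesis varphi0 : coefs varphi 0 = 0.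
Hypothesis varphi_supp : (qsupport neg varphi `<=`
  totally_noncharacteristic_integers p mu)%classic.

Let p_gt1 := prime_gt1 p_prime.

Lemma nondegenerate_neq0 : mu != 0.
Proof.
by apply: contraTneq mu_nondeg => ->; rewrite /nondegenerate_char /eval_mu !horner0 unitr0.
Qed.

Lemma red_qexp n : (p %| n)%N -> red (qexp neg n)%:~R = 0.
Proof.
rewrite rmorph_int rmorphM /= -pmulrn (dvdn_pcharf (residue_pchar p_prime k_def)).
by move/eqP->; rewrite mulr0.
Qed.

Lemma red_char_coef i n : (p %| n)%N -> red (char_coef neg mu i n) = red mu`_i`_0.
Proof.
by move=> p_n; rewrite /char_coef -horner_map /= red_qexp // horner_coef0 coef_map.
Qed.

Lemma red_char_coef0 n : (p %| n)%N -> red (char_coef neg mu 0 n) != 0.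
Proof.
move=> p_n; rewrite red_char_coef // -(red_unit R_def k_def).
by move: mu_nondeg; rewrite /nondegenerate_char /eval_mu !horner_coef0.
Qed.

Lemma varphi_suppP n : coefs varphi n != 0 ->
  ~~ (p %| n)%N /\ char_coef neg mu 0 n \is a GRing.unit.
Proof.
move=> nz_n; have supp_n : qsupport neg varphi (qexp neg n) by exists n.
have [np_n] := varphi_supp supp_n.
rewrite eval_mu_char_coef (red_unit R_def k_def) => ndvd; split.
  apply: contra np_n; rewrite /qexp => /dvdnP[m ->].
  by rewrite PoszM mulrA dvdz_mull.
by apply/eqP=> red0; apply: ndvd; case: k_def => _ <-.
Qed.

Lemma varphi_dvd0 n : (p %| n)%N -> coefs varphi n = 0.
Proof. by move=> p_n; apply/eqP/negP => /negP/varphi_suppP[]; rewrite p_n. Qed.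

Lemma solution_eq u n : is_solution p phi neg mu varphi u ->
  char_coef neg mu 0 n * coefs u n + char_tail p phi neg mu u n = coefs varphi n.
Proof. by case=> _ <- _; rewrite coefs_char_act ?nondegenerate_neq0. Qed.

Lemma solution_supp u n : is_solution p phi neg mu varphi u ->
  char_coef neg mu 0 n = 0 -> coefs u n = 0.
Proof.
case=> _ _ supp0 c0; apply: contrapT => /eqP nz_n.
suff : (qsupport neg u `&` characteristic_integers mu)%classic (qexp neg n).
  by rewrite supp0.
by split; [exists n | rewrite /characteristic_integers /= eval_mu_char_coef].
Qed.

(** By induction the tails at [n] agree. Where [mu(0, kappa)] vanishes, the support condition forces
    the coefficient to be 0; elsewhere the factor cancels in the domain [R]. *)
Lemma solution_unique u v :
  is_solution p phi neg mu varphi u -> is_solution p phi neg mu varphi v -> u = v.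
Proof.
move=> u_sol v_sol; apply: pseriesP; elim/ltn_ind => n IH.
have [->|n_neq0] := eqVneq n 0%N; first by case: v_sol u_sol => -> _ _ [].
have [c0|nz_c] := eqVneq (char_coef neg mu 0 n) 0.
  by rewrite (solution_supp v_sol c0) (solution_supp u_sol c0).
apply: (mulfI nz_c); apply: (addIr (char_tail p phi neg mu u n)).
rewrite solution_eq // (@eq_char_tail _ _ _ _ p_gt1 _ _ v) ?lt0n //.
by rewrite solution_eq.
Qed.

Lemma char_solutionP : is_solution p phi neg mu varphi (char_solution p phi neg mu varphi).
Proof.
set u := char_solution p phi neg mu varphi.
have u_eq n : coefs u n = if (n == 0)%N || (char_coef neg mu 0 n \isn't a GRing.unit)
    then 0 else (coefs varphi n - char_tail p phi neg mu u n) / char_coef neg mu 0 n.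
  exact: esym (congr1 (fun w => coefs w n) (solution_stepE phi neg p_gt1 mu varphi)).
split; first by rewrite u_eq.
  apply: pseriesP => n; have [->|n_neq0] := eqVneq n 0%N.
    by rewrite varphi0 solution_at0 // u_eq.
  rewrite coefs_char_act ?nondegenerate_neq0 // u_eq (negPf n_neq0) /=.
  have [nu|] := ifPn; last by rewrite negbK => ?; rewrite mulrC divrK // subrK.
  (* Here [mu(0, kappa)] is not a unit, so p does not divide [n] and the tail is empty, while
     [varphi_n = 0]. *)
  rewrite mulr0 add0r char_tail0.
    by apply/esym/eqP/negP => /negP/varphi_suppP[_]; rewrite (negPf nu).
  by apply: contra nu => p_n; rewrite (red_unit R_def k_def) red_char_coef0.
apply/seteqP; split=> // _ [[n /= nz_n <-]].
rewrite /characteristic_integers /= eval_mu_char_coef => c0.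
by case/eqP: nz_n; rewrite [LHS]u_eq c0 unitr0 orbT.
Qed.

End SolutionTheory.

(** * Algebraic power series in characteristic 0 *)

Lemma frac_num_den (A : idomainType) (x : {fraction A}) :
  exists d n : A, d != 0 /\ tofrac d * x = tofrac n.
Proof.
exists \d_(generic_quotient.repr x), \n_(generic_quotient.repr x); split.
  exact: denom_ratioP.
rewrite -[x in _ * x]reprK /tofrac; unlock; rewrite -[LHS]FracField.pi_mul.
apply/eqmodP; rewrite /= FracField.equivfE /FracField.mulf.
by rewrite !numden_Ratio ?mulf_neq0 ?denom_ratioP ?oner_eq0 // mul1r mulr1.
Qed.

Lemma common_denominator (A : idomainType) (I : finType) (x : I -> {fraction A}) :
  exists d (n : I -> A), d != 0 /\ forall i, tofrac d * x i = tofrac (n i).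
Proof.
have /choice[d /choice[n dn]] := fun i => frac_num_den (x i).
exists (\prod_i d i), (fun i => n i * \prod_(j | j != i) d j); split=> [|i].
  by apply/prodf_neq0 => i _; case: (dn i).
rewrite (bigD1 i) //= !tofracM mulrAC; congr (_ * _).
by case: (dn i).
Qed.

(** Solve over the fraction field and clear denominators. *)
Lemma linear_dependence (A : idomainType) n (M : 'M[A]_(n.+1, n)) :
  exists2 w : 'I_n.+1 -> A, exists i, w i != 0 &
    forall j, \sum_i w i * M i j = 0.
Proof.
pose N := map_mx (@tofrac A) M.
have /rowV0Pn[v /sub_kermxP vN /rV0Pn[i0 nz_v]] : kermx N != 0.
  by rewrite kermx_eq0 /row_free neq_ltn ltnS rank_leq_col.
have [d [w [nz_d wE]]] := common_denominator (fun i => v 0 i).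
exists w => [|j].
  exists i0; rewrite -tofrac_eq0 -wE mulf_neq0 ?tofrac_eq0 //.
apply/eqP; rewrite -tofrac_eq0 rmorph_sum; apply/eqP.
transitivity (tofrac d * (v *m N) 0 j); last by rewrite vN mxE mulr0.
rewrite mxE mulr_sumr; apply: eq_bigr => i _.
by rewrite rmorphM /= -wE mxE mulrA.
Qed.

(** * Linear differential equations of algebraic series *)

Section EulerDerivation.
Variable K : idomainType.
Implicit Types f g : pseries K.

(** The derivation [t d/dt], which is diagonal on monomials and so shifts no index. *)
Definition euler f : pseries K := PSeries (fun n => n%:R * coefs f n).

Lemma euler_is_zmod_morphism : zmod_morphism euler.
Proof. by move=> f g; apply: pseriesP => n /=; rewrite mulrBr. Qed.
HB.instance Definition _ :=
  GRing.isZmodMorphism.Build (pseries K) (pseries K) euler euler_is_zmod_morphism.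

Lemma eulerM f g : euler (f * g) = euler f * g + f * euler g.
Proof.
apply: pseriesP => n /=; rewrite mulr_sumr -big_split; apply: eq_bigr => i _ /=.
have le_in : (i <= n)%N by rewrite -ltnS.
by rewrite -{1}(subnKC le_in) natrD; ring.
Qed.

Lemma coefs_iter_euler i f n : coefs (iter i euler f) n = n%:R ^+ i * coefs f n.
Proof. by elim: i => [|i IH]; rewrite ?mul1r //= IH exprS mulrA. Qed.

Lemma euler_of_poly (Q : {poly K}) :
  euler (pseries_of_poly Q) = pseries_of_poly ('X * Q^`()).
Proof.
apply: pseriesP => -[|n] /=; rewrite coefXM /= ?mul0r // coef_deriv.
by rewrite mulr_natl.
Qed.

Lemma euler1 : euler 1 = 0.
Proof.
have := euler_of_poly 1; rewrite rmorph1 => ->.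
by rewrite derivC mulr0 rmorph0.
Qed.

Lemma eulerX f n : f * euler (f ^+ n) = n%:R * f ^+ n * euler f.
Proof.
elim: n => [|n IH]; first by rewrite euler1 mulr0 !mul0r.
rewrite exprS eulerM mulrDr mulrCA IH -natr1.
by ring.
Qed.

End EulerDerivation.

Section DFinite.
Variables (K : idomainType) (u : pseries K).
Local Notation emb := (@pseries_of_poly K).
Local Notation theta := (@euler K).
Local Notation ev P := (map_poly emb P).[u].

Definition poly_in (x : pseries K) := exists P : {poly {poly K}}, x = ev P.

Lemma poly_inD x y : poly_in x -> poly_in y -> poly_in (x + y).
Proof. by move=> [P ->] [Q ->]; exists (P + Q); rewrite rmorphD hornerD. Qed.
Lemma poly_inM x y : poly_in x -> poly_in y -> poly_in (x * y).
Proof. by move=> [P ->] [Q ->]; exists (P * Q); rewrite rmorphM hornerM. Qed.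
Lemma poly_inC Q : poly_in (emb Q).
Proof. by exists Q%:P; rewrite map_polyC hornerC. Qed.
Lemma poly_in_nat n : poly_in n%:R.
Proof. by exists n%:R; rewrite rmorph_nat hornerMn hornerC. Qed.
Lemma poly_inN x : poly_in x -> poly_in (- x).
Proof. by move=> [P ->]; exists (- P); rewrite rmorphN hornerN. Qed.
Lemma poly_in_gen : poly_in u.
Proof. by exists 'X; rewrite map_polyX hornerX. Qed.
Lemma poly_inX x n : poly_in x -> poly_in (x ^+ n).
Proof. by move=> [P ->]; exists (P ^+ n); rewrite rmorphXn horner_exp. Qed.

(** The difference is the value at [u] of the polynomial obtained by applying [theta] to the
    coefficients of [P]. *)
Lemma euler_ev (P : {poly {poly K}}) : poly_in (theta (ev P) - ev P^`() * theta u).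
Proof.
elim/poly_ind: P => [|P Q [C CE]].
  by exists 0; rewrite deriv0 !rmorph0 !horner0 raddf0 mul0r subr0.
have -> : theta (ev (P * 'X + Q%:P)) - ev (P * 'X + Q%:P)^`() * theta u =
    ev C * u + emb ('X * Q^`()).
  rewrite -CE derivMXaddC !(rmorphD, rmorphM) /= map_polyX map_polyC !hornerE /=.
  rewrite raddfD /= eulerM euler_of_poly rmorphM.
  by ring.
by apply: poly_inD; [apply: poly_inM; [exists C | exact: poly_in_gen] | exact: poly_inC].
Qed.

Variable P : {poly {poly K}}.
Hypothesis P_u : ev P = 0.
Local Notation W := (ev P^`()).
Hypothesis W_neq0 : W != 0.

Lemma euler_poly_in x : poly_in x -> poly_in (W * theta x).
Proof.
have WP : poly_in W by exists P^`().
have Wu : poly_in (W * theta u).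
  have := poly_inN (euler_ev P).
  by rewrite P_u raddf0 sub0r opprK.
case=> Q ->; have -> : W * theta (ev Q) =
    W * (theta (ev Q) - ev Q^`() * theta u) + ev Q^`() * (W * theta u) by ring.
apply: poly_inD; apply: poly_inM => //; first exact: euler_ev.
by exists Q^`().
Qed.

(* W theta(u) = - P^theta(u) lies in K[t][u], where P^theta is P with theta applied
   to its coefficients; hence each further application of theta costs a factor W^2. *)
Lemma iter_euler_poly_in i : poly_in (W ^+ (2 * i) * iter i theta u).
Proof.
have WP : poly_in W by exists P^`().
elim: i => [|i IH]; first by rewrite mul1r; apply: poly_in_gen.
(* The Leibniz rule for [W^(2i) theta^i(u)], multiplied by [W^2] and solved for the term with
   [theta^(i+1)(u)]. *)
have -> : W ^+ (2 * i.+1) * iter i.+1 theta u =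
    W * (W * theta (W ^+ (2 * i) * iter i theta u)) -
    (2 * i)%:R * (W * theta W) * (W ^+ (2 * i) * iter i theta u).
  have := eulerX W (2 * i); rewrite eulerM mulnS exprD /=.
  move: (W ^+ (2 * i)) (theta (W ^+ (2 * i))) (theta W) (iter i theta u) => X tX tW x tXE.
  have -> : W * (W * (tX * x + X * theta x)) = W * ((W * tX) * x + W * X * theta x) by ring.
  by rewrite tXE; ring.
apply: poly_inD; first by apply: poly_inM => //; apply: euler_poly_in.
apply/poly_inN/poly_inM => //; apply: poly_inM; first exact: poly_in_nat.
exact: euler_poly_in.
Qed.

(** With [d] the degree of [P], the series [W^(2d) theta^i(u)] for [i <= d] are polynomials in [u].
    Reduced modulo [P] they have degree less than [d], so these [d + 1] series are dependent over
    [K[t]], and [W^(2d)] cancels. *)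
Lemma algebraic_dfinite : exists m (Q : 'I_m -> {poly K}),
  (exists i, Q i != 0) /\ \sum_i emb (Q i) * iter i theta u = 0.
Proof.
have nz_P : P != 0 by apply: contraNneq W_neq0 => ->; rewrite deriv0 rmorph0 horner0.
pose d := (size P).-1.
have /choice[C CE] (i : 'I_d.+1) : exists C, W ^+ (2 * d) * iter i theta u = ev C.
  have le_id : (i <= d)%N by rewrite -ltnS.
  have -> : (2 * d = 2 * (d - i) + 2 * i)%N by rewrite -mulnDr subnK.
  rewrite exprD -mulrA; apply: poly_inM.
    by apply: poly_inX; exists P^`().
  exact: iter_euler_poly_in.
(* Over [K[t]] only pseudo-division by [P] is available: it multiplies [C i] by a power of the
   leading coefficient. *)
pose l i := lead_coef P ^+ scalp (C i) P.
pose r i := C i %% P.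
have rE i : ev (r i) = emb (l i) * ev (C i).
  have := congr1 (fun q => ev q) (Pdiv.Idomain.divp_eq (C i) P).
  rewrite /= map_polyZ hornerZ rmorphD rmorphM hornerD hornerM P_u mulr0 add0r.
  by rewrite -/(l i) => ->.
have szr i : (size (r i) <= d)%N.
  by rewrite -ltnS prednK ?size_poly_gt0 // Pdiv.Idomain.ltn_modp.
have [w nz_w wr] := linear_dependence (\matrix_(i < d.+1, j < d) (r i)`_j).
exists d.+1, (fun i => w i * l i); split.
  have [i nz_wi] := nz_w; exists i.
  by rewrite mulf_neq0 // expf_neq0 ?lead_coef_eq0.
apply: (mulfI (expf_neq0 (2 * d) W_neq0)); rewrite mulr0 mulr_sumr.
transitivity (\sum_i emb (w i) * ev (r i)).
  by apply: eq_bigr => i _; rewrite rE -CE rmorphM; ring.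
transitivity (ev (\sum_i w i *: r i)).
  rewrite rmorph_sum horner_sum; apply: eq_bigr => i _ /=.
  by rewrite map_polyZ hornerZ.
suffices -> : \sum_i w i *: r i = 0 by rewrite rmorph0 horner0.
apply/polyP=> j; rewrite coef_sum coef0; have [lt_jd|le_dj] := ltnP j d.
  rewrite -[RHS](wr (Ordinal lt_jd)); apply: eq_bigr => i _.
  by rewrite coefZ mxE.
by rewrite big1 // => i _; rewrite coefZ nth_default ?mulr0 // (leq_trans (szr i)).
Qed.

End DFinite.

Lemma poly_nat_roots (K : idomainType) (T : {poly K}) :
  (forall n, (n%:R == 0 :> K) = (n == 0)%N) ->
  (forall N, exists2 s, (N <= s)%N & root T s%:R) -> T = 0.
Proof.
move=> charK inf_roots; apply/eqP/negP => /negP nz_T.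
have natr_inj (m n : nat) : m%:R = n%:R :> K -> m = n.
  wlog le_mn : m n / (m <= n)%N.
    by move=> IH; case/orP: (leq_total m n) => /IH // IH' /esym/IH'.
  move=> /eqP; rewrite eq_sym -subr_eq0 -natrB // charK subn_eq0 => le_nm.
  by apply/eqP; rewrite eqn_leq le_mn.
have [rs [szrs uniq_rs all_rs]] : exists rs : seq nat,
    [/\ size rs = size T, uniq rs & all (fun s => root T s%:R) rs].
  elim: (size T) => [|n [rs [szrs uniq_rs all_rs]]]; first by exists [::].
  have [s le_s root_s] := inf_roots (\max_(t <- rs) t).+1.
  exists (s :: rs); split=> /=; rewrite ?szrs ?root_s ?uniq_rs ?andbT //.
  by apply: contraTN le_s => s_rs; rewrite -leqNgt (leq_bigmax_seq _ s_rs).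
have := @max_poly_roots _ T [seq n%:R | n <- rs] nz_T.
rewrite size_map szrs ltnn all_map map_inj_in_uniq => [/(_ all_rs uniq_rs)//|].
by move=> m n _ _; apply: natr_inj.
Qed.

(** Take the coefficient [s + l], where [s] ends a gap of length [L]. By induction [T t = 0] for
    [t < l]; for [t > l], either [u_(s+l-t)] lies in the gap or [t] exceeds all degrees. What
    remains is [T l] at [s] times [u_s], so [T l] has infinitely many roots. *)
Lemma dfinite_gaps (K : idomainType) (u : pseries K) m (Q : 'I_m -> {poly K}) :
    (forall n, (n%:R == 0 :> K) = (n == 0)%N) ->
    (forall L N, exists2 s, (N <= s)%N & coefs u s != 0 /\
       forall j, (j < s)%N -> (s <= j + L)%N -> coefs u j = 0) ->
    \sum_i pseries_of_poly (Q i) * iter i (@euler K) u = 0 ->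
  forall i, Q i = 0.
Proof.
move=> charK gaps sum0.
(* T l is the polynomial in n multiplying u_n in the coefficient n + l of the sum. *)
pose T l : {poly K} := \poly_(i < m) oapp (fun i' => (Q i')`_l) 0 (insub i).
have coefT l (i : 'I_m) : (T l)`_i = (Q i)`_l by rewrite coef_poly ltn_ord valK.
suffices T0 l : T l = 0 by move=> i; apply/polyP => l; rewrite -coefT T0 !coef0.
pose L := \max_i size (Q i).
elim/ltn_ind: l => l IH; apply: poly_nat_roots => // N.
have [s le_s [nz_s gap_s]] := gaps L N; exists s => //.
have /(congr1 (fun f : pseries K => coefs f (s + l)%N)) := sum0.
rewrite coefs_sum /=; under eq_bigr => i _ do
  under eq_bigr => t _ do rewrite coefs_iter_euler -coefT mulrA.
rewrite exchange_big /= (bigD1 (inord l)) //= [X in _ + X]big1 => [|t].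
  rewrite addr0 inordK ?ltnS ?leq_addl // addnK.
  have TE : (T l).[s%:R] = \sum_(i < m) (T l)`_i * s%:R ^+ i.
    by rewrite (@horner_coef_wide _ m) ?size_poly.
  by rewrite -mulr_suml -TE => /eqP; rewrite mulf_eq0 (negPf nz_s) orbF.
rewrite -val_eqE /= inordK ?ltnS ?leq_addl // => ne_tl.
have [lt_tl|le_lt] := ltnP t l.
  by rewrite big1 // => i _; rewrite IH // coef0 !mul0r.
have lt_lt : (l < t)%N by rewrite ltn_neqAle eq_sym ne_tl.
have [lt_tL|le_Lt] := ltnP t L; last first.
  rewrite big1 // => i _; rewrite coefT nth_default ?mul0r //.
  by apply: leq_trans le_Lt; apply: leq_bigmax.
rewrite big1 // => i _; rewrite gap_s ?mulr0 //; first by have := ltn_ord t; lia.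
by have := ltn_ord t; lia.
Qed.

(** * Additive polynomials *)

Section AdditivePoly.
Variables (p : nat) (p_prime : prime p).

Definition additive_poly (F : comNzRingType) m (c : 'I_m -> F) : {poly F} :=
  \sum_i c i *: 'X^(p ^ i).

Lemma map_additive_poly (F L : comNzRingType) (f : {rmorphism F -> L}) m (c : 'I_m -> F) :
  map_poly f (additive_poly c) = additive_poly (fun i => f (c i)).
Proof.
by rewrite rmorph_sum; apply: eq_bigr => i _ /=; rewrite map_polyZ map_polyXn.
Qed.

Lemma horner_additive_poly (F : comNzRingType) m (c : 'I_m -> F) (x : F) :
  (additive_poly c).[x] = \sum_i c i * x ^+ (p ^ i).
Proof. by rewrite horner_sum; apply: eq_bigr => i _; rewrite !hornerE. Qed.

Lemma additive_poly_shift (F : comNzRingType) m (c : 'I_m -> F) (x : F) :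
  p \in [pchar F] ->
  additive_poly c \Po ('X - x%:P) = additive_poly c - (additive_poly c).[x]%:P.
Proof.
move=> charF; rewrite horner_additive_poly /additive_poly raddf_sum rmorph_sum.
rewrite -sumrB; apply: eq_bigr => i _ /=.
rewrite comp_polyZ comp_Xn_poly pchar_expBn ?pchar_poly //.
by rewrite scalerBr -polyC_exp -!mul_polyC -rmorphM.
Qed.

Lemma deriv_additive_poly (F : comNzRingType) m (c : 'I_m.+1 -> F) :
  p \in [pchar F] -> (additive_poly c)^`() = (c ord0)%:P.
Proof.
move=> charF; rewrite /additive_poly raddf_sum (bigD1 ord0) //= big1 => [|i].
  by rewrite addr0 derivZ derivXn -mul_polyC mulr1.
rewrite -val_eqE /= => i_neq0; rewrite derivZ derivXn.
by rewrite -mulr_natr natrX pcharf0 ?pchar_poly // expr0n (negPf i_neq0) mulr0 scaler0.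
Qed.

Lemma additive_poly0 (F : comNzRingType) m (c : 'I_m -> F) : (additive_poly c).[0] = 0.
Proof.
rewrite horner_additive_poly big1 // => i _.
by rewrite expr0n expn_eq0 -leqn0 leqNgt prime_gt0 // mulr0.
Qed.

Variables (F E : fieldType) (j : {rmorphism F -> E}) (z : E).
Hypothesis charF : p \in [pchar F].
Variables (m : nat) (c : 'I_m.+1 -> F) (lc : F) (rs : seq F) (g : F).
Hypothesis c0 : c ord0 != 0.
Hypothesis lc_neq0 : lc != 0.
Hypothesis split_c : additive_poly c = lc *: \prod_(a <- rs) ('X - a%:P).
Hypothesis z_root : (map_poly j (additive_poly c)).[z] = j g.

(** The derivative of the additive polynomial is the nonzero constant [c ord0], so its roots are
    simple. *)
Let uniq_rs : uniq rs.
Proof.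
rewrite -separable_prod_XsubC.
have -> : \prod_(a <- rs) ('X - a%:P) = lc^-1 *: additive_poly c.
  by rewrite split_c scalerA mulVf // scale1r.
rewrite separable_poly.unlock derivZ deriv_additive_poly // -mul_polyC -rmorphM.
rewrite (@eqp_coprimepr _ _ _ 1) ?coprimep1 // polyC_eqp1.
by rewrite mulf_neq0 ?invr_eq0.
Qed.

Let B : {poly F} := lc^-1 *: (additive_poly c - g%:P).

Let B_neq0 : B != 0.
Proof.
apply: contraNneq c0 => B0; rewrite -polyC_eq0 -deriv_additive_poly //.
have -> : additive_poly c = lc *: B + g%:P by rewrite scalerA divff // scale1r subrK.
by rewrite B0 scaler0 add0r derivC.
Qed.

Let Bz : root (map_poly j B) z.
Proof.
by rewrite rootE map_polyZ hornerZ rmorphB /= map_polyC hornerD hornerN hornerC z_root subrr mulr0.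
Qed.

(** Needed to construct [F(z)] as an abstract extension; an annihilator of least degree is
    irreducible. *)
Lemma minimal_annihilator : exists2 q : {poly F}, irreducible_poly q & root (map_poly j q) z.
Proof.
pose P n := `[< exists q : {poly F}, [/\ q != 0, root (map_poly j q) z & size q = n] >].
have exP : exists n, P n by exists (size B); apply/asboolP; exists B.
case: (ex_minnP exP) => n /asboolP[q [nz_q qz szq]] minn.
exists q => //; apply/(subfx_irreducibleP qz nz_q) => q' q'z nz_q'.
by rewrite szq; apply: minn; apply/asboolP; exists q'.
Qed.

(** The roots of [B] in [F(x)] are the [x + a] with [a] in [rs], so [F(x)] is the splitting field of
    a separable polynomial. An automorphism is determined by its translation [x -> x + a] with [a]
    in [F]; translations commute and have order dividing p. *)
Lemma additive_abelian : abelian_killed_by p j z.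
Proof.
have [q irr_q qz] := minimal_annihilator.
have nz_q := irredp_neq0 irr_q.
pose L0 : fieldExtType F := SubFieldExtType qz irr_q.
pose inj0 : {rmorphism L0 -> E} := @subfx_inj F E j z q.
pose x : L0 := subfx_root j z q.
have inj0A a : inj0 a%:A = j a := subfx_inj_base qz nz_q a.
have inj0x : inj0 x = z := subfx_inj_root qz nz_q.
have genx (y : L0) : exists r, y = (map_poly (in_alg L0) r).[x].
  by have [r rE] := subfxEroot qz nz_q y; exists r.
have BL : map_poly (in_alg L0) B = \prod_(y <- [seq x + in_alg L0 a | a <- rs]) ('X - y%:P).
  have root_x : (map_poly (in_alg L0) (additive_poly c)).[x] = in_alg L0 g.
    by apply: (fmorph_inj inj0); rewrite inj0A -horner_map -map_poly_comp (eq_map_poly inj0A) inj0x.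
  have charL : p \in [pchar L0] by rewrite pchar_lalg.
  have -> : map_poly (in_alg L0) B = in_alg L0 lc^-1 *: (map_poly (in_alg L0) (additive_poly c)
      - ((map_poly (in_alg L0) (additive_poly c)).[x])%:P).
    by rewrite root_x map_polyZ rmorphB /= map_polyC.
  rewrite big_map.
  have := additive_poly_shift (fun i => in_alg L0 (c i)) x charL.
  rewrite -!map_additive_poly => <-; rewrite split_c map_polyZ comp_polyZ scalerA.
  rewrite -rmorphM mulVf // rmorph1 scale1r !rmorph_prod; apply: eq_bigr => a _ /=.
  by rewrite map_polyXsubC rmorphB /= comp_polyX comp_polyC -addrA -opprD rmorphD.
have full_x : <<1; x>>%VS = {:L0}%VS.
  apply/vspaceP=> y; rewrite memvf; have [r ->] := genx y.
  by rewrite mempx_Fadjoin ?alg_polyOver.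
(* This puts [x] itself among the roots [x + a], so that they generate [L0]. *)
have rs0 : 0 \in rs.
  by rewrite -root_prod_XsubC -(rootZ _ _ lc_neq0) -split_c rootE additive_poly0.
have spl : splittingFieldFor 1 (map_poly (in_alg L0) B) {:L0}.
  exists [seq x + in_alg L0 a | a <- rs]; first by rewrite BL eqpxx.
  apply/eqP; rewrite eqEsubv subvf -full_x /=; apply/FadjoinP; split; first exact: sub1v.
  by apply: seqv_sub_adjoin; apply/mapP; exists 0; rewrite //= scale0r addr0.
have ax : SplittingField.axiom L0.
  by exists (map_poly (in_alg L0) B); rewrite ?alg_polyOver.
pose L : splittingFieldType F := HB.pack L0 (FieldExt_isSplittingField.Build F L0 ax).
have sepB : separable_poly (map_poly (in_alg L0) B).
  rewrite BL separable_prod_XsubC map_inj_uniq ?uniq_rs // => a b /addrI.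
  exact: fmorph_inj.
exists L, inj0, x; split; first by [].
have galB (h : gal_of {:L}) : h \in 'Gal({:L} / 1)%g ->
    forall r : {poly F}, h (map_poly (in_alg L0) r).[x] = (map_poly (in_alg L0) r).[h x].
  move=> hG r; rewrite -horner_map /=.
  by rewrite (fixedPoly_gal (sub1v _) hG) ?alg_polyOver.
have gal_ext (h h' : gal_of {:L}) : h \in 'Gal({:L} / 1)%g -> h' \in 'Gal({:L} / 1)%g ->
    h x = h' x -> h = h'.
  move=> hG h'G eq_x; apply/eqP/gal_eqP => y _; have [r ->] := genx y.
  by rewrite !galB // eq_x.
have gal_shift (h : gal_of {:L}) : h \in 'Gal({:L} / 1)%g -> exists a, h x = x + in_alg L0 a.
  move=> hG; have : root (map_poly (in_alg L0) B) (h x).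
    rewrite rootE -galB // BL (rootP _) ?rmorph0 // root_prod_XsubC.
    by apply/mapP; exists 0; rewrite //= scale0r addr0.
  by rewrite BL root_prod_XsubC => /mapP[a _ ->]; exists a.
have gal_shift_alg (h : gal_of {:L}) a : h \in 'Gal({:L} / 1)%g ->
    h (x + in_alg L0 a) = h x + in_alg L0 a.
  move=> hG; rewrite rmorphD; congr (_ + _).
  by rewrite /= (fixed_gal (sub1v _) hG) // rpredZ ?mem1v.
split.
- apply/splitting_galoisField; exists (map_poly (in_alg L0) B).
  by rewrite alg_polyOver.
- apply/centsP => h hG h' h'G; apply: gal_ext; rewrite ?groupM //.
  have [a hx] := gal_shift h hG; have [b h'x] := gal_shift h' h'G.
  by rewrite !galM ?memvf // hx h'x !gal_shift_alg // hx h'x addrAC.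
move=> h hG; have [a hx] := gal_shift h hG.
have hn n : (h ^+ n)%g x = x + in_alg L0 a *+ n.
  elim: n => [|n IH]; first by rewrite expg0 gal_id addr0.
  by rewrite expgSr galM ?memvf // IH -rmorphMn gal_shift_alg // hx rmorphMn mulrS addrA.
apply: gal_ext; rewrite ?groupX ?group1 // hn gal_id.
by rewrite -rmorphMn -mulr_natr (pcharf0 charF) mulr0 rmorph0 addr0.
Qed.

End AdditivePoly.

(** * Power series in characteristic p *)

Section PseriesFrobenius.
Variables (p : nat) (k : idomainType).
Hypothesis charK : p \in [pchar k].

Lemma pchar_pseries : p \in [pchar (pseries k)].
Proof.
rewrite inE (pcharf_prime charK) /= -(rmorph_nat (@pseries_of_poly k)).
by rewrite -polyC_natr (pcharf0 charK) polyC0 rmorph0.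
Qed.

Lemma coefs_mulXn (f : pseries k) m n :
  coefs (pseries_of_poly 'X^m * f) n = if (n < m)%N then 0 else coefs f (n - m).
Proof.
rewrite /=; case: ltnP => [lt_nm|le_mn].
  by rewrite big1 // => i _; rewrite coefXn ltn_eqF ?mul0r // (leq_ltn_trans _ lt_nm) // -ltnS.
rewrite (bigD1 (Ordinal (leq_ltn_trans le_mn (ltnSn n)))) //= coefXn eqxx mul1r.
rewrite big1 ?addr0 // => i; rewrite -val_eqE /= => ne_im.
by rewrite coefXn (negPf ne_im) mul0r.
Qed.

Lemma coefsD (f g : pseries k) n : coefs (f + g) n = coefs f n + coefs g n.
Proof. by []. Qed.

Lemma coefs_mulC (a : k) (f : pseries k) n :
  coefs (pseries_of_poly a%:P * f) n = a * coefs f n.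
Proof.
rewrite /= big_ord_recl /= coefC subn0 big1 ?addr0 // => i _.
by rewrite coefC mul0r.
Qed.

(** Induction on [n], peeling off the constant term: with [q = p^i], [f = f_0 + t f'] gives
    [f^q = f_0^q + t^q f'^q]. *)
Lemma coefs_exp_pchar i (f : pseries k) n :
  coefs (f ^+ (p ^ i)) n = if (p ^ i %| n)%N then coefs f (n %/ p ^ i)%N ^+ (p ^ i) else 0.
Proof.
have q_gt0 : (0 < p ^ i)%N by rewrite expn_gt0 prime_gt0 ?(pcharf_prime charK).
elim/ltn_ind: n f => n IH f.
pose f' := PSeries (fun n => coefs f n.+1).
have fE : f = pseries_of_poly (coefs f 0)%:P + pseries_of_poly 'X^1 * f'.
  by apply: pseriesP => -[|m]; rewrite coefsD coefs_mulXn /= coefC ?addr0 ?add0r ?subn1.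
rewrite {1}fE exprDn_pchar; last first.
  by rewrite pnatX pnatE ?(pcharf_prime charK) // pchar_pseries.
rewrite exprMn -!rmorphXn -exprM mul1n coefsD coefs_mulXn.
rewrite [X in X + _]/= coefC; have [->|n_neq0] := eqVneq n 0%N.
  by rewrite q_gt0 dvdn0 div0n addr0.
rewrite add0r; case: ltnP => [lt_nq|le_qn].
  by rewrite gtnNdvd ?lt0n.
rewrite IH; last by rewrite -subn_gt0 subKn.
rewrite dvdn_subl ?dvdnn //; case: ifP => // q_n.
by rewrite divnBr ?dvdnn // divnn q_gt0 /= subn1 prednK // divn_gt0.
Qed.

End PseriesFrobenius.

(** * Reduction and transcendence of the solution *)

Lemma algebraic_pseries_root (K : fieldType) (u : pseries K) :
    algebraicOver (@ratfun_to_laurent K) (tofrac u) ->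
  exists2 P : {poly {poly K}}, P != 0 & (map_poly (@pseries_of_poly K) P).[u] = 0.
Proof.
case=> f nz_f f_u.
have [d [n [nz_d dn]]] := common_denominator (fun i : 'I_(size f) => f`_i).
pose P := \poly_(i < size f) oapp n 0 (insub i).
have coefP (i : 'I_(size f)) : P`_i = n i by rewrite coef_poly ltn_ord valK.
have PE : map_poly (@tofrac _) P = tofrac d *: f.
  apply/polyP => i; rewrite coef_map coefZ /=; have [lt_i|le_i] := ltnP i (size f).
    by rewrite (coefP (Ordinal lt_i)) -dn.
  by rewrite coef_poly ltnNge le_i /= rmorph0 nth_default ?mulr0.
exists P.
  apply: contra_neq nz_f => P0; apply: (scalerI (a := tofrac d)); rewrite ?tofrac_eq0 //.
  by rewrite -PE P0 rmorph0 scaler0.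
apply/eqP; rewrite -tofrac_eq0 -horner_map -map_poly_comp.
rewrite -(eq_map_poly (@ratfun_to_laurent_poly K)) map_poly_comp PE map_polyZ.
by rewrite hornerZ (rootP f_u) mulr0.
Qed.

(** Replace [P] by its derivative as long as the latter vanishes at [u]. The degree drops, and in
    characteristic 0 a zero derivative would make [P] a nonzero constant, which cannot vanish at
    [u]. *)
Lemma separable_annihilator (K : idomainType) (u : pseries K) (P : {poly {poly K}}) :
    (forall n, (n%:R == 0 :> K) = (n == 0)%N) ->
    P != 0 -> (map_poly (@pseries_of_poly K) P).[u] = 0 ->
  exists2 Q : {poly {poly K}}, (map_poly (@pseries_of_poly K) Q).[u] = 0 &
    (map_poly (@pseries_of_poly K) Q^`()).[u] != 0.
Proof.
move=> charK; have [n] := ubnP (size P).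
elim: n P => // n IH P ltPn nz_P P_u.
have [P'_u|] := eqVneq ((map_poly (@pseries_of_poly K) P^`()).[u]) 0; last by exists P.
have [P'0|nz_P'] := eqVneq P^`() 0.
  have PE : P = (P`_0)%:P.
    apply/polyP => -[|i]; rewrite coefC //=; apply/polyP => l.
    have /(congr1 (fun q : {poly {poly K}} => q`_i`_l)) := P'0.
    rewrite coef_deriv coefMn !coef0 -mulr_natr => /eqP.
    by rewrite mulf_eq0 charK orbF => /eqP.
  move: P_u; rewrite PE map_polyC hornerC /= -(rmorph0 (@pseries_of_poly K)).
  by move/pseries_of_poly_inj => P0; case/eqP: nz_P; rewrite PE P0.
apply: IH P'_u => //; apply: leq_trans (lt_size_deriv nz_P) _.
by rewrite -ltnS.
Qed.

Lemma gaps_transcendental (K : fieldType) (u : pseries K) :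
    (forall n, (n%:R == 0 :> K) = (n == 0)%N) ->
    (forall L N, exists2 s, (N <= s)%N & coefs u s != 0 /\
       forall j, (j < s)%N -> (s <= j + L)%N -> coefs u j = 0) ->
  ~ algebraicOver (@ratfun_to_laurent K) (tofrac u).
Proof.
move=> charK gaps /algebraic_pseries_root[P nz_P P_u].
have [Q Q_u Q'_u] := separable_annihilator charK nz_P P_u.
have [m [C [[i nz_Ci] sum0]]] := algebraic_dfinite Q_u Q'_u.
by case/eqP: nz_Ci; apply: dfinite_gaps sum0 i.
Qed.

Lemma short_posP (p : nat) (P : pred nat) (S : set int) :
    short_pos p S -> (forall z, S z <-> exists2 n : nat, P n & z = n%:Z) ->
  exists a b : nat, [/\ (0 < a)%N, (2 * b < p * a)%N, exists n, P n
    & forall n, P n -> (a <= n <= b)%N].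
Proof.
move=> [_ posS [m [M [Sm SM bnd ratio]]]] SE.
have /SE[a Pa mE] := Sm; have /SE[b Pb ME] := SM.
have a_gt0 : (0 < a)%N by have := posS _ Sm; rewrite mE ltz_nat.
exists a, b; split=> //; last 1 first.
- by move=> n Pn; rewrite -!lez_nat -mE -ME; apply: bnd; apply/SE; exists n.
- move: ratio; rewrite mE ME ltr_pdivrMr ?ltr0z ?ltz_nat // -!pmulrn.
  rewrite mulrAC ltr_pdivlMr // -!natrM ltr_nat mulnC => lt_ba.
  by rewrite lt_ba.
by exists a.
Qed.

Lemma short_qsupport (p : nat) (neg : bool) (A : idomainType) (f : pseries A) :
    short p (qsupport neg f) ->
  exists a b : nat, [/\ (0 < a)%N, (2 * b < p * a)%N, exists n, coefs f n != 0
    & forall n, coefs f n != 0 -> (a <= n <= b)%N].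
Proof.
have qexpT n : qexp true n = - n%:Z by rewrite /qexp expr1 mulN1r.
have qexpF n : qexp false n = n%:Z by rewrite /qexp expr0 mul1r.
case: neg => -[shortS|shortS].
(* All exponents of a series in [q^-1] are at most 0, so its non-empty support cannot consist of
   positive integers. *)
- have [_ posS [m [_ [Sm _ _ _]]]] := shortS; have := posS _ Sm.
  by case: Sm => n _ <-; rewrite qexpT oppr_gt0 ltz_nat.
- apply: short_posP shortS _ => z; split=> [[_ [n nz_n <-] <-]|[n nz_n ->]].
    by exists n; rewrite // qexpT opprK.
  by exists (qexp true n); [exists n | rewrite qexpT opprK].
- apply: short_posP shortS _ => z; split=> [[n nz_n <-]|[n nz_n ->]].
    by exists n; rewrite // qexpF.
  by exists n; rewrite // qexpF.
have [_ posS [m [_ [Sm _ _ _]]]] := shortS; have := posS _ Sm.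
by case: Sm => _ [n _ <-] <-; rewrite qexpF oppr_gt0 ltz_nat.
Qed.

(** * Integrality of the reduction, gaps and transcendence *)

Section Corollary.
Variables (p : nat) (R : idomainType) (k : fieldType) (red : {rmorphism R -> k}).
Hypothesis p_prime : prime p.
Hypothesis R_def : is_completed_Zpur p R.
Hypothesis k_def : is_residue_field p red.
Variables (phi : {rmorphism R -> R}) (mu : {poly {poly R}}) (neg : bool).
Hypothesis phi_def : is_Frobenius_lift p red phi.
Hypothesis mu_nondeg : nondegenerate_char mu.
Variable varphi : pseries R.
Hypothesis varphi_supp : (qsupport neg varphi `<=`
  totally_noncharacteristic_integers p mu)%classic.
Variable u : pseries R.
Hypothesis u_sol : is_solution p phi neg mu varphi u.

Let p_gt1 := prime_gt1 p_prime.
Let charK := residue_pchar p_prime k_def.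

Lemma red_iter_phi i x : red (iter i phi x) = red x ^+ (p ^ i).
Proof.
case: phi_def => _ red_phi; elim: i => //= i IH.
by rewrite red_phi IH -exprM -expnSr.
Qed.

Lemma red_solution_eq n :
  \sum_(i < size mu | (p ^ i %| n)%N) red (char_coef neg mu i (n %/ p ^ i)) *
    red (coefs u (n %/ p ^ i)) ^+ (p ^ i) = red (coefs varphi n).
Proof.
case: u_sol => _ <- _; rewrite coefs_char_act_sum // rmorph_sum; apply: eq_bigr => i _.
by rewrite rmorphM /= red_iter_phi.
Qed.

(** The tail is empty, so [mu(0, kappa) u_n = varphi_n]. If [varphi_n] is nonzero the factor is a
    unit; otherwise [u_n = 0], by the support condition when the factor vanishes. *)
Lemma solution_prime_to_p n : ~~ (p %| n)%N -> red (coefs varphi n) = 0 ->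
  red (coefs u n) = 0.
Proof.
move=> np_n red0; have := solution_eq mu_nondeg n u_sol.
rewrite char_tail0 // addr0 => uE; have [v0|nz_v] := eqVneq (coefs varphi n) 0.
  suff -> : coefs u n = 0 by rewrite rmorph0.
  move/eqP: uE; rewrite v0 mulf_eq0 => /orP[/eqP|/eqP//].
  exact: solution_supp u_sol.
have [_] := varphi_suppP R_def k_def varphi_supp nz_v.
rewrite (red_unit R_def k_def) => nz_c; apply/eqP.
by rewrite -(mulrI_eq0 _ (mulfI nz_c)) -rmorphM uE red0.
Qed.

Section Reduction.
Variable f : {poly k}.
Hypothesis f_def : map_pseries red varphi = pseries_of_poly f.
Local Notation ubar := (map_pseries red u).

Let c (i : 'I_(size mu)) : k := red mu`_i`_0.

(** Coefficient [n] of [A(ubar)] differs from the reduced equation only in the terms where p does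
    not divide [n / p^i]; for large [n], [u_(n/p^i)] reduces to 0 in those terms, and so does
    [varphi_n]. *)
Lemma red_solution_additive : exists G : {poly k},
  (map_poly (@pseries_of_poly k) (map_poly (@polyC k) (additive_poly p c))).[ubar] =
    pseries_of_poly G.
Proof.
(* [D] is chosen so that [n >= D] forces [n / p^i >= size f] for all [i < size mu]. *)
set v := _.[ubar]; pose D := (size f * p ^ size mu)%N.
have vE n : coefs v n = \sum_(i < size mu | (p ^ i %| n)%N)
    c i * red (coefs u (n %/ p ^ i)) ^+ (p ^ i).
  rewrite /v !map_additive_poly horner_additive_poly coefs_sum [RHS]big_mkcond.
  apply: eq_bigr => i _; rewrite coefs_mulC (coefs_exp_pchar charK).
  by case: ifP; rewrite ?mulr0.
suffices v0 n : (D <= n)%N -> coefs v n = 0.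
  exists (\poly_(n < D) coefs v n); apply: pseriesP => n /=; rewrite coef_poly.
  by case: ltnP => // /v0.
move=> le_Dn; rewrite vE.
have fE m : (size f <= m)%N -> red (coefs varphi m) = 0.
  move=> le_m; have /(congr1 (fun w => coefs w m)) /= -> := f_def.
  exact: nth_default.
have le_Dn' : (size f <= n)%N by apply: leq_trans le_Dn; rewrite leq_pmulr ?expn_gt0 ?prime_gt0.
rewrite -[RHS](fE n) // -red_solution_eq; apply: eq_bigr => i p_n.
have [p_ni|np_ni] := boolP (p %| n %/ p ^ i)%N.
  by rewrite (red_char_coef p_prime k_def).
rewrite [red (coefs u _)]solution_prime_to_p //.
  by rewrite expr0n expn_eq0 -leqn0 leqNgt prime_gt0 // !mulr0.
apply: fE; rewrite leq_divRL ?expn_gt0 ?prime_gt0 //.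
by apply: leq_trans le_Dn; rewrite leq_mul2l leq_exp2l // ltnW ?orbT.
Qed.

End Reduction.

(** If [varphi_n = 0], the equation makes some [u_(n/p^i)] with [i > 0] nonzero, and one
    descends. *)
Lemma solution_orbit n : coefs u n != 0 ->
  exists n0 e, n = (n0 * p ^ e)%N /\ coefs varphi n0 != 0.
Proof.
elim/ltn_ind: n => n IH nz_n.
have [v0|nz_v] := eqVneq (coefs varphi n) 0; last by exists n, 0; rewrite muln1.
have n_gt0 : (0 < n)%N.
  by rewrite lt0n; apply: contra_neq nz_n => ->; case: u_sol.
have := solution_eq mu_nondeg n u_sol; rewrite v0 => uE.
have nz_c : char_coef neg mu 0 n != 0.
  by apply: contra_neq nz_n; apply: solution_supp u_sol.
have : char_tail p phi neg mu u n != 0.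
  apply: contraTneq nz_n => t0; rewrite negbK; move/eqP: uE.
  by rewrite t0 addr0 mulf_eq0 (negPf nz_c).
rewrite /char_tail big_nat_cond => nz_t.
have [i [i_gt0 p_n nz_i]] : exists i, [/\ (0 < i)%N, (p ^ i %| n)%N & coefs u (n %/ p ^ i) != 0].
  apply: contrapT => no_i; case/eqP: nz_t; rewrite big1 // => i /andP[/andP[i_gt0 _] p_n].
  have [->|nz_i] := eqVneq (coefs u (n %/ p ^ i)) 0; first by rewrite iter_rmorph0 mulr0.
  by case: no_i; exists i.
have [n0 [e [nE nz_n0]]] := IH _ (divn_pexp_lt p_gt1 i_gt0 n_gt0) nz_i.
by exists n0, (e + i)%N; rewrite expnD mulnA -nE divnK.
Qed.

Lemma solution_orbit_infinite n0 : unmixed red mu -> coefs varphi n0 != 0 ->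
  forall E, exists2 e, (E <= e)%N & coefs u (n0 * p ^ e) != 0.
Proof.
move=> [unm [r0 r0_neq0 nz_r0]] nz_n0 E; apply: contrapT => u_fin.
pose x e := coefs u (n0 * p ^ e)%N.
have x_fin e : (E <= e)%N -> x e = 0.
  by move=> le_e; apply/eqP; apply: contrapT => /negP nz; apply: u_fin; exists e.
have p_neq0 := completed_p_neq0 p_prime R_def.
(* p does not divide [n0], so the equation there reads [mu(0, kappa) u_n0 = varphi_n0]. *)
have x0 : x 0 != 0.
  rewrite /x muln1; apply: contra_neq (nz_n0) => u0.
  rewrite -(solution_eq mu_nondeg n0 u_sol) u0 mulr0 add0r char_tail0 //.
  by have [] := varphi_suppP R_def k_def varphi_supp nz_n0.
(* Divide by the largest power p^v dividing all coefficients x_e; the last e = N with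
   y_e nonzero mod p contradicts the equation at index n0 p^(N + r), r being the
   largest index with mubar_r0 <> 0. *)
have [v [y [xE nz_y]]] : exists v (y : nat -> R),
    (forall e, x e = p%:R ^+ v * y e) /\ exists e, red (y e) != 0.
  have ex_v : exists v, `[< ~ forall e, pdvd p v (x e) >].
    apply: contrapT => no_v; case/eqP: x0; apply: (completed_sep R_def) => v.
    by apply: contrapT => nv; apply: no_v; exists v; apply/asboolP => /(_ 0%N).
  case: (ex_minnP ex_v) => -[|v] /asboolP nv minv.
    by case: nv => e; apply: pdvd0.
  have /choice[y yE] : forall e, pdvd p v (x e).
    by apply: contrapT => nv'; have := minv v (asboolT nv'); rewrite ltnn.
  exists v, y; split=> //; apply: contrapT => no_e; apply: nv => e.
  have /(proj2 k_def)[z zE] : red (y e) = 0.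
    by apply/eqP; apply: contrapT => /negP nz; apply: no_e; exists e.
  by exists z; rewrite yE zE expr1 exprSr mulrA.
have y_fin e : (E <= e)%N -> red (y e) = 0.
  move=> /x_fin; rewrite xE => /eqP; rewrite mulf_eq0 expf_eq0 (negPf p_neq0) andbF /=.
  by move/eqP->; rewrite rmorph0.
have [N nz_N maxN] : exists2 N, red (y N) != 0 & forall e, (N < e)%N -> red (y e) = 0.
  have bnd e : red (y e) != 0 -> (e <= E)%N.
    by apply: contraR; rewrite -ltnNge => /ltnW/y_fin ->.
  case: (ex_maxnP nz_y bnd) => N nz_N maxN; exists N => // e lt_Ne.
  by apply/eqP; apply: contraTT lt_Ne => /maxN; rewrite -leqNgt.
have [r [r_gt0 nz_r maxr]] : exists r, [/\ (0 < r)%N, red mu`_r`_0 != 0 &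
    forall i, (r < i)%N -> red mu`_i`_0 = 0].
  pose P i := (0 < i)%N && (red mu`_i`_0 != 0).
  have exP : exists i, P i by exists r0; rewrite /P lt0n r0_neq0.
  have bnd i : P i -> (i <= size mu)%N.
    move=> /andP[_]; apply: contraR; rewrite -ltnNge => /ltnW le_i.
    by rewrite (nth_default _ le_i) coef0 rmorph0.
  case: (ex_maxnP exP bnd) => r /andP[r_gt0 nz_r] maxr; exists r; split=> // -[|i] // lt_ri.
  by apply/eqP; apply: contraTT lt_ri => nz_i; rewrite -leqNgt; apply: maxr.
have lt_r : (r < size mu)%N.
  rewrite ltnNge; apply: contra nz_r => le_r.
  by rewrite (nth_default _ le_r) coef0 rmorph0.
(* Unmixedness makes the coefficient of [xi_p^i] constant mod p for [i > 0]. *)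
have coef_unm i n : (0 < i)%N -> red (char_coef neg mu i n) = red mu`_i`_0.
  move=> i_gt0; rewrite /char_coef -horner_map /=.
  have -> : map_poly red mu`_i = (red mu`_i`_0)%:P.
    apply/polyP => -[|j]; rewrite coef_map coefC //= unm //.
    by rewrite muln_eq0 negb_or -lt0n i_gt0.
  by rewrite hornerC.
have np_n0 : ~~ (p %| n0)%N by have [] := varphi_suppP R_def k_def varphi_supp nz_n0.
pose n := (n0 * p ^ (N + r))%N.
have p_n : (p %| n)%N by rewrite dvdn_mull // -(prednK r_gt0) addnS expnS dvdn_mulr.
have le_exp i : (p ^ i %| n)%N -> (i <= N + r)%N.
  rewrite /n Gauss_dvdr; last first.
    by rewrite coprimeXl // prime_coprime.
  by rewrite dvdn_Pexp2l.
have divE i : (i <= N + r)%N -> (n %/ p ^ i = n0 * p ^ (N + r - i))%N.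
  by move=> le_i; rewrite /n -{1}(subnK le_i) expnD mulnA mulnK ?expn_gt0 ?prime_gt0.
have sum0 : \sum_(i < size mu | (p ^ i %| n)%N) char_coef neg mu i (n %/ p ^ i) *
    iter i phi (y (N + r - i)%N) = 0.
  apply: (mulfI (expf_neq0 v p_neq0)); rewrite mulr0 mulr_sumr.
  transitivity (coefs varphi n); last exact: (varphi_dvd0 R_def k_def varphi_supp p_n).
  case: u_sol => _ <- _; rewrite coefs_char_act_sum //; apply: eq_bigr => i p_i.
  rewrite divE ?le_exp // -/(x _) xE [in RHS](pmulrn 1 p) iter_rmorph_int -pmulrn.
  by rewrite mulrCA.
move/(congr1 red): sum0; rewrite rmorph0 rmorph_sum (bigD1 (Ordinal lt_r)) /=; last first.
  by rewrite dvdn_mull // dvdn_exp2l // leq_addl.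
rewrite big1 => [|i /andP[/le_exp le_i]].
  rewrite addr0 rmorphM /= red_iter_phi addnK coef_unm // => /eqP.
  by rewrite mulf_eq0 (negPf nz_r) expf_eq0 (negPf nz_N) andbF.
(* For [i < r], including [i = 0], the index [N + r - i] exceeds [N], so [y] vanishes there mod p;
   for [i > r] it is [mubar_i0] that vanishes. *)
rewrite -val_eqE /= neq_ltn => /orP[lt_ir|lt_ri].
  rewrite rmorphM /= red_iter_phi maxN ?expr0n ?expn_eq0; last by lia.
  by rewrite -leqn0 leqNgt prime_gt0 // mulr0.
by rewrite rmorphM /= coef_unm ?maxr ?mul0r // (leq_ltn_trans _ lt_ri).
Qed.

(** Take for [s] the first index at least [a p^(e+1)] with nonzero coefficient. Nonzero coefficients
    before it lie in blocks of exponent at most [e], hence at indices at most [b p^e], and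
    [(b + 1) p^e <= a p^(e+1)] leaves a gap longer than [L]. *)
Lemma solution_gaps a b : (0 < a)%N -> (2 * b < p * a)%N ->
    (forall n, coefs varphi n != 0 -> (a <= n <= b)%N) ->
    (forall T, exists2 n, (T <= n)%N & coefs u n != 0) ->
  forall L N, exists2 s, (N <= s)%N & coefs u s != 0 /\
    forall j, (j < s)%N -> (s <= j + L)%N -> coefs u j = 0.
Proof.
(* This [e] ensures both [p^e > L] and [a p^(e+1) >= N]. *)
move=> a_gt0 lt_ab bnd inf L N; pose e := (L + N)%N.
have ex_s : exists s, (a * p ^ e.+1 <= s)%N && (coefs u s != 0).
  by have [s le_s nz_s] := inf (a * p ^ e.+1)%N; exists s; rewrite le_s.
case: (ex_minnP ex_s) => s /andP[le_s nz_s] min_s; exists s.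
  apply: leq_trans le_s; apply: leq_trans (leq_pmull _ a_gt0).
  by apply: leq_trans (ltnW (ltn_expl _ p_gt1)); rewrite -addnS -addSnnS leq_addl.
split=> // j lt_js le_sj; apply/eqP; apply: contraTT le_sj => nz_j.
have lt_j : (j < a * p ^ e.+1)%N.
  by rewrite ltnNge; apply/negP => le_j; have := min_s j; rewrite le_j nz_j leqNgt lt_js => /(_ isT).
have [n0 [f [jE nz_n0]]] := solution_orbit nz_j.
have /andP[le_a le_b] := bnd _ nz_n0.
have lt_fe : (f < e.+1)%N.
  rewrite -(ltn_exp2l _ _ p_gt1) -(ltn_pmul2l a_gt0); apply: leq_ltn_trans lt_j.
  by rewrite jE leq_mul2r le_a orbT.
have le_jb : (j <= b * p ^ e)%N by rewrite jE leq_mul // leq_exp2l.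
have lt_e : (L < p ^ e)%N by apply: leq_ltn_trans (ltn_expl e p_gt1); apply: leq_addr.
rewrite -ltnNge; apply: leq_trans le_s; rewrite expnS mulnA (mulnC a).
apply: (@leq_trans (b.+1 * p ^ e)%N); first by rewrite mulSn addnC -addSn leq_add.
by rewrite leq_mul2r; apply/orP; right; lia.
Qed.

Lemma solution_transcendental (K : fieldType) (inc : {rmorphism R -> K}) :
    is_p_localization p inc -> unmixed red mu -> short p (qsupport neg varphi) ->
  ~ algebraicOver (@ratfun_to_laurent K) (tofrac (map_pseries inc u)).
Proof.
move=> [inj_inc _] unm /short_qsupport[a [b [a_gt0 lt_ab [n0 nz_n0] bnd]]].
have inc_eq0 x : (inc x == 0) = (x == 0) by rewrite -(inj_eq inj_inc) rmorph0.
have inf T : exists2 n, (T <= n)%N & coefs u n != 0.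
  have [e le_e nz_e] := solution_orbit_infinite unm nz_n0 T.
  exists (n0 * p ^ e)%N => //; apply: leq_trans le_e _.
  apply: leq_trans (ltnW (ltn_expl e p_gt1)) _; apply: leq_pmull.
  by have /andP[+ _] := bnd _ nz_n0; apply: leq_trans.
apply: gaps_transcendental => [n|L N].
  by rewrite -(rmorph_nat inc) inc_eq0 (completed_pchar0 p_prime R_def k_def).
have [s le_s [nz_s gap_s]] := solution_gaps a_gt0 lt_ab bnd inf L N.
by exists s => //=; rewrite inc_eq0; split=> // j lt_j le_s'; rewrite gap_s ?rmorph0.
Qed.

Lemma solution_reduction (f : {poly k}) : map_pseries red varphi = pseries_of_poly f ->
  integralOver (@pseries_of_poly k) (map_pseries red u) /\
  abelian_killed_by p (@ratfun_to_laurent k) (tofrac (map_pseries red u)).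
Proof.
move=> f_def; set ubar := map_pseries red u.
have nz_mu := nondegenerate_neq0 mu_nondeg.
have [G] := red_solution_additive f_def.
(* [size mu] is rewritten as a successor so that the index [ord0] is available. *)
have szmu : size mu = (size mu).-1.+1 by rewrite prednK ?size_poly_gt0.
pose c (i : 'I_(size mu).-1.+1) := red mu`_i`_0.
have -> : additive_poly p (fun i : 'I_(size mu) => red mu`_i`_0) = additive_poly p c.
  rewrite /additive_poly -(big_mkord xpredT (fun i => red mu`_i`_0 *: 'X^(p ^ i))).
  by rewrite [in LHS]szmu big_mkord.
set A := additive_poly p c => A_u.
have c0 : c ord0 != 0.
  rewrite /c -(red_char_coef p_prime k_def mu neg 0 (dvdn0 p)).
  exact: (red_char_coef0 p_prime R_def k_def neg mu_nondeg (dvdn0 p)).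
have nz_A : A != 0.
  apply: contraNneq c0 => A0; rewrite -polyC_eq0.
  by rewrite -(deriv_additive_poly c charK) -/A A0 deriv0.
have [rs /eqpP[[x y] /= /andP[nz_x nz_y] eqA]] := residue_split p_prime R_def k_def nz_A.
have AE : A = (x^-1 * y) *: \prod_(z <- rs) ('X - z%:P).
  by rewrite -scalerA -eqA scalerA mulVf // scale1r.
have lc_neq0 : x^-1 * y != 0 by rewrite mulf_neq0 ?invr_eq0.
pose emb := @pseries_of_poly k.
split.
  pose M := \prod_(z <- rs) ('X - z%:P).
  pose lc := x^-1 * y.
  (* Since [A = lc M] and [A(ubar) = G], this polynomial vanishes at [ubar]. *)
  exists (map_poly (@polyC k) M - (lc^-1 *: G)%:P); last first.
    rewrite rootE rmorphB hornerD /= map_polyC hornerN hornerC.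
    have -> : M = lc^-1 *: A by rewrite AE scalerA mulVf // scale1r.
    rewrite map_polyZ map_polyZ hornerZ A_u subr_eq0 -mul_polyC.
    by apply/eqP/esym/(rmorphM emb).
  (* [M] is not constant because [A] has nonzero derivative; subtracting a constant therefore leaves
     it monic. *)
  have szM : (1 < size (map_poly (@polyC k) M))%N.
    rewrite size_map_poly ltnNge; apply/negP => /size1_polyC M1.
    case/eqP: c0; apply: (@polyC_inj k).
    rewrite -(deriv_additive_poly c charK) -/A AE -/M M1 polyC0.
    by rewrite derivZ derivC scaler0.
  rewrite monicE lead_coefDl.
    by rewrite lead_coef_map -/M (monicP (monic_prod_XsubC _ _ _)) rmorph1.
  by rewrite size_polyN size_polyC; apply: leq_ltn_trans szM; apply: leq_b1.
(* The roots of [A] lie in [k], hence in the base field [k(t)] as constants. *)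
apply: (@additive_abelian p p_prime _ _ _ _ _ _ (fun i => tofrac (c i)%:P)
  (tofrac (x^-1 * y)%:P) [seq tofrac a%:P | a <- rs] (tofrac G)).
- exact: (rmorph_pchar (@tofrac {poly k} \o @polyC k)) charK.
- by rewrite tofrac_eq0 polyC_eq0.
- by rewrite tofrac_eq0 polyC_eq0.
- have := congr1 (map_poly (@tofrac {poly k} \o @polyC k)) AE.
  rewrite map_additive_poly map_polyZ rmorph_prod big_map => -> /=; congr (_ *: _).
  by apply: eq_bigr => a _; rewrite /= map_polyXsubC.
rewrite [RHS]ratfun_to_laurent_poly -A_u !map_additive_poly !horner_additive_poly rmorph_sum.
apply: eq_bigr => i _; rewrite rmorphM rmorphXn; congr (_ * _).
exact: ratfun_to_laurent_poly.
Qed.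

End Corollary.

Theorem corollary6p16
  (p : nat) (p_prime : prime p) (p_neq2 : p != 2%N)
  (R : idomainType) (R_def : is_completed_Zpur p R)
  (K : fieldType) (inc : {rmorphism R -> K}) (K_def : is_p_localization p inc)
  (k : fieldType) (red : {rmorphism R -> k}) (k_def : is_residue_field p red)
  (phi : {rmorphism R -> R}) (phi_def : is_Frobenius_lift p red phi)
  (mu : {poly {poly R}}) (mu_nondeg : nondegenerate_char mu)
  (neg : bool) (varphi : pseries R) (varphi0 : coefs varphi 0 = 0)
  (varphi_supp : (qsupport neg varphi `<=`
                    totally_noncharacteristic_integers p mu)%classic) :
  [/\ exists! u : pseries R, is_solution p phi neg mu varphi u,
      (exists f : {poly k}, map_pseries red varphi = pseries_of_poly f) ->
      forall u : pseries R, is_solution p phi neg mu varphi u ->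
        integralOver (@pseries_of_poly k) (map_pseries red u) /\
        abelian_killed_by p (@ratfun_to_laurent k)
          (tofrac (map_pseries red u)) &
      unmixed red mu -> short p (qsupport neg varphi) ->
      forall u : pseries R, is_solution p phi neg mu varphi u ->
        ~ algebraicOver (@ratfun_to_laurent K)
            (tofrac (map_pseries inc u))].
Proof.
split.
- have sol := char_solutionP p_prime R_def k_def phi mu_nondeg varphi0 varphi_supp.
  by exists (char_solution p phi neg mu varphi); split=> // v; apply: solution_unique sol.
- case=> f f_def u u_sol.
  exact: (solution_reduction p_prime R_def k_def phi_def mu_nondeg varphi_supp u_sol f_def).
move=> unm short_varphi u u_sol.
exact: (solution_transcendental p_prime R_def k_def phi_def mu_nondeg varphi_supp u_sol K_def).
Qed.
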